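(* Let $A$ be a finite set, let $(\mu_n)_{n\in\mathbb Z}$ be a family of probability measures on $A$, let $X=A^{\mathbb Z}$, $\mu=\bigotimes_{n\in\mathbb Z}\mu_n$, and let $T:X\to X$ be the shift $(Tx)_n=x_{n-1}$. Assume that $T$ is nonsingular with respect to $\mu$, i.e. $\mu\circ T\sim\mu$. Then: (i) If $\inf_{n\in\mathbb N}\min_{a\in A}\mu_n(a)>0$ and $T$ is conservative, then $T$ is weakly mixing. (ii) If $\# A=2$, $\sup_{n\in\mathbb N}\max_{a\in A}\left|\log\left(\frac{\mu_n(a)}{\mu_{n+1}(a)}\right)\right|<\infty$, and $T$ is conservative, then $T$ is weakly mixing. (iii) Suppose that either $\inf_{n\in\mathbb N}\min_{a\in A}\mu_n(a)>0$, or $\# A=2$ and $\sup_{n\in\mathbb N}\max_{a\in A}\left|\log\left(\frac{\mu_n(a)}{\mu_{n+1}(a)}\right)\right|<\infty$. If for some integer $p>1$ the $p$-fold product $T\times\cdots\times T$ (on $(X^p,\mu^{\otimes p})$) is conservative, then this $p$-fold product $T\times\cdots\times T$ is weakly mixing.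
   Context: $\mathbb N=\{1,2,\dots\}$. The condition $\sup_{n\in\mathbb N}\max_{a\in A}|\log(\mu_n(a)/\mu_{n+1}(a))|<\infty$ is understood to include that $\mu_n(a)>0$ for all $a\in A$, $n\in\mathbb N$. A nonsingular action of a countable group $G$ on a $\sigma$-finite standard measure space $(Y,\nu)$ is a Borel action $Q=(Q_g)_{g\in G}$ with $\nu\circ Q_g\sim\nu$ (same null sets) for every $g$. An invertible nonsingular transformation $T$ is identified with the nonsingular $\mathbb Z$-action $(T^n)_{n\in\mathbb Z}$. For infinite $G$, $Q$ is conservative if for every measurable $B$ with $\nu(B)>0$ and for a.e. $y\in B$, the set $\{g\in G: Q_gy\in B\}$ is infinite. $Q$ is ergodic if every $Q$-invariant measurable set is null or conull. $Q$ is weakly mixing if for each ergodic measure preserving $G$-action $R=(R_g)_{g\in G}$ on a standard probability space, the product $G$-action $(Q_g\times R_g)_{g\in G}$ is ergodic (with respect to the product measure). *)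

(* Defs.v *)
From HB Require Import structures.
From mathcomp Require Import all_boot all_order all_algebra.
From mathcomp Require Import all_classical all_reals all_analysis.

Set Implicit Arguments.
Unset Strict Implicit.
Unset Printing Implicit Defensive.

Import Order.TTheory GRing.Theory Num.Theory.
Import numFieldNormedType.Exports.

Local Open Scope classical_set_scope.
Local Open Scope ring_scope.

#[short(type="finMeasurableType")]
HB.structure Definition FinMeasurable d := {T of Finite T & Measurable d T}.

Definition cylinders (I : Type) d (Y : measurableType d) : set (set (I -> Y)) :=
  \bigcup_(i in [set: I])
    preimage_set_system setT (fun x : I -> Y => x i) measurable.

(* The set Y^I with the product sigma-algebra. *)
Definition prod_space (I : Type) d (Y : measurableType d) :=
  g_sigma_algebraType (@cylinders I d Y).

(* By Dynkin's pi-lambda theorem this determines P: it says that P is the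
   product of the probability measures m_i. *)
Definition is_product_measure (R : realType) (I : choiceType) d
    (Y : measurableType d) (m : I -> probability Y R)
    (P : probability (prod_space I Y) R) : Prop :=
  forall (s : seq I) (B : I -> set Y), uniq s -> (forall i, measurable (B i)) ->
    P [set x | forall i, i \in s -> B i (x i)] =
    (\prod_(i <- s) m i (B i))%E.

Definition is_Zaction (Y : Type) (Q : int -> Y -> Y) : Prop :=
  Q 0 = id /\ forall m n : int, Q (m + n) = Q m \o Q n.

Section ergodic_theory.
Context d (Y : measurableType d) (R : realType).
Implicit Types (nu : set Y -> \bar R) (Q : int -> Y -> Y).

Definition conservative nu Q : Prop :=
  forall B : set Y, measurable B -> (0 < nu B)%E ->
    {ae nu, forall y, B y -> infinite_set [set n : int | B (Q n y)]}.

Definition ergodic nu Q : Prop :=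
  forall B : set Y, measurable B -> (forall n : int, Q n @^-1` B = B) ->
    nu B = 0%E \/ nu (~` B) = 0%E.

Definition measure_preserving nu Q : Prop :=
  forall (n : int) (B : set Y), measurable B -> nu (Q n @^-1` B) = nu B.

(* Y is the Borel space of a Polish space S, via the bijection f. *)
Definition standard_borel : Prop :=
  exists (S : completePseudoMetricType R) (f : Y -> S),
    [/\ hausdorff_space S, @second_countable S, bijective f &
        forall B : set S, <<s [set U : set S | open U] >> B <->
                          measurable (f @^-1` B)].

End ergodic_theory.

Arguments standard_borel {d} Y R.

Definition prod_action (Y W : Type) (Q : int -> Y -> Y) (S : int -> W -> W) :
    int -> Y * W -> Y * W :=
  fun n yw => (Q n yw.1, S n yw.2).

Definition weakly_mixing d (Y : measurableType d) (R : realType)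
    (nu : set Y -> \bar R) (Q : int -> Y -> Y) : Prop :=
  forall d' (W : measurableType d') (P : probability W R) (S : int -> W -> W),
    standard_borel W R -> is_Zaction S ->
    (forall n : int, measurable_fun setT (S n)) ->
    measure_preserving P S -> ergodic P S ->
    ergodic (nu \x P)%E (prod_action Q S).

Section seq_shift.
Context d (A : measurableType d).

Definition seq_shift (x : prod_space int A) : prod_space int A :=
  fun n : int => x (n - 1).

Definition shift_action (m : int) (x : prod_space int A) : prod_space int A :=
  fun n : int => x (n - m).

Lemma shift_action1 : shift_action 1 = seq_shift.
Proof. by []. Qed.

Lemma shift_action_Zaction : is_Zaction shift_action.
Proof.
split; first by apply/funext => x; apply/funext => n; rewrite /shift_action subr0.
move=> m n; apply/funext => x; apply/funext => k.
by rewrite /shift_action /= opprD addrA.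
Qed.

(* mu o T ~ mu *)
Definition shift_nonsingular (R : realType)
    (mu : probability (prod_space int A) R) : Prop :=
  forall B : set (prod_space int A), measurable B ->
    mu (seq_shift @` B) = 0%E <-> mu B = 0%E.

End seq_shift.

Arguments seq_shift {d A} x.
Arguments shift_action {d} A m x.

Definition power_action (p : nat) d (Y : measurableType d) (Q : int -> Y -> Y) :
    int -> prod_space 'I_p Y -> prod_space 'I_p Y :=
  fun n x i => Q n (x i).

Arguments power_action p {d Y} Q.

(* In the next two definitions n ranges over N = {1, 2, ...}. *)
Definition inf_min_pos d (A : finMeasurableType d) (R : realType)
    (mu_ : int -> probability A R) : Prop :=
  (0 < ereal_inf [set \big[mine/+oo]_(a : A) mu_ n [set a]
                 | n in [set n : int | (0 < n)%R]])%E.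

Definition log_ratio_bounded d (A : finMeasurableType d) (R : realType)
    (mu_ : int -> probability A R) : Prop :=
  (forall (n : int) (a : A), 0 < n -> (0 < mu_ n [set a])%E) /\
  (ereal_sup [set \big[maxe/-oo]_(a : A)
                    `|ln (fine (mu_ n [set a]) / fine (mu_ (n + 1)%R [set a]))|%:E
             | n in [set n : int | (0 < n)%R]] < +oo)%E.

(* Main.v *)
From HB Require Import structures.
Require Import Defs.
From mathcomp Require Import all_boot all_order all_algebra.
From mathcomp Require Import all_classical all_reals all_analysis.
From mathcomp Require Import measurable_realfun.
From mathcomp Require Import ring lra zify.

(** The proof is a Hopf argument that uses a maximal inequality in place of the
ratio ergodic theorem.

Let T act on X, let (W, P, S) be ergodic and probability preserving, and let B
be an invariant subset of X x W for the product measure N.  Take two words p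
and q on the same finite set s of sites, and compare a point whose s-part is p
with the point obtained from it by writing q instead.  Under T^k the two orbits
differ only on the sites s + k, which leave every finite window, and exchanging
the shifted words there multiplies the measure by a ratio of weights.  Words
are called comparable when this ratio stays bounded for large k.  If a set C of
positive measure lay outside B while its modification C' lay inside B, then
approximate B by an event F that depends on finitely many sites.  On the one
hand N(T^k C' & F) is at most a constant times N(T^k C & F).  On the other hand
F agrees with B up to a small set H, and the maximal inequality
[ratio_maximal_inequality] shows that, away from a small set of starting
points, orbits meet H with small frequency, relative to the weights N(T^k C).
These weights have a divergent sum because T is conservative
([conservative_divergent], [product_divergent]).  As T^k C' is contained in B
and T^k C avoids B, this is a contradiction.  So B does not notice the exchange
of comparable words: [swap_invariant], [swap_exchange].

The two hypotheses on the marginals say which words are comparable.  If all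
letters have probability bounded below at positive sites, any two letters at one site are
comparable ([comparable_single]), and B is then independent of every coordinate
([single_letter_independent]).  If there are two letters a, b and neighbouring
marginals have bounded ratios, only the words ab and ba on two sites are
comparable ([comparable_exchange]).  In that case compare the site j0 with many
others: under a change of measure that gives j0 the law of site n, the exchange
symmetry turns the correlation of B with the letter at n into the correlation
with the letter at j0, up to the factor pa(n) pb(n).  The test functions
obtained from different n are orthogonal, so Cauchy-Schwarz bounds the square of
the correlation times the sum of pa(n) pb(n) ([two_letter_independent]).  That
sum diverges, for otherwise the measure would have atoms, and two atoms that
differ at one site cannot both be periodic, although a conservative map must
make every atom periodic ([conservative_diverging]).

A set that is independent of every coordinate is X x V up to a null set, with V
invariant under S; ergodicity of S concludes ([letter_independent_trivial]).

The p-fold power is treated by the same argument: a point of (A^Z)^p is a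
configuration on the sites {1..p} x Z, so both cases are generalised Bernoulli
shifts ([bernoulli_shift]).  What has to be added is that the power of a
nonsingular map is nonsingular ([nonsingular_power]). *)

Set Implicit Arguments.
Unset Strict Implicit.
Unset Printing Implicit Defensive.

Import Order.TTheory GRing.Theory Num.Theory.
Import numFieldNormedType.Exports.

Local Open Scope classical_set_scope.
Local Open Scope ring_scope.

(** * Real values of probability measures, uniqueness, approximation *)

Lemma measurable_preimage d (Y : measurableType d) d' (Z : measurableType d')
    (f : Y -> Z) B :
  measurable_fun setT f -> measurable B -> measurable (f @^-1` B).
Proof. by move=> mf mB; rewrite -[X in measurable X]setTI; exact: mf. Qed.

Section scaled_measure_unique.
Context (R : realType) d1 (Y1 : measurableType d1) (P1 : probability Y1 R)
  d2 (Y2 : measurableType d2) (P2 : probability Y2 R)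
  dX (X : measurableType dX).

(** Equality of measures in the form in which it is used below: both sides are
restrictions of a probability measure to an event, seen through a map into a
third space, and one of them is rescaled. *)
Lemma scaled_measure_unique (G : set (set X)) (f1 : Y1 -> X) (f2 : Y2 -> X)
    (E1 : set Y1) (E2 : set Y2) (a : R) :
  measurable = <<s G >> -> setI_closed G -> G setT ->
  measurable_fun setT f1 -> measurable_fun setT f2 ->
  measurable E1 -> measurable E2 -> 0 <= a ->
  (forall D, G D -> fine (P1 (E1 `&` f1 @^-1` D)) = a * fine (P2 (E2 `&` f2 @^-1` D))) ->
  forall D, measurable D ->
    fine (P1 (E1 `&` f1 @^-1` D)) = a * fine (P2 (E2 `&` f2 @^-1` D)).
Proof.
move=> Gm GI GT mf1 mf2 mE1 mE2 a0 GE D mD.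
pose nu1 : {measure set X -> \bar R} := pushforward (mrestr P1 mE1) f1.
pose nu2 : {measure set X -> \bar R} := mscale (NngNum a0) (pushforward (mrestr P2 mE2) f2).
have nu1E B : nu1 mf1 B = P1 (E1 `&` f1 @^-1` B) by rewrite setIC.
have nu2E B : nu2 mf2 B = (a%:E * P2 (E2 `&` f2 @^-1` B))%E.
  by rewrite setIC.
have mpre1 B : measurable B -> measurable (E1 `&` f1 @^-1` B).
  by move=> mB; apply: measurableI => //; exact: measurable_preimage.
have mpre2 B : measurable B -> measurable (E2 `&` f2 @^-1` B).
  by move=> mB; apply: measurableI => //; exact: measurable_preimage.
have fin1 B : measurable B -> P1 (E1 `&` f1 @^-1` B) \is a fin_num.
  by move=> mB; apply: fin_num_measure; exact: mpre1.
have fin2 B : measurable B -> P2 (E2 `&` f2 @^-1` B) \is a fin_num.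
  by move=> mB; apply: fin_num_measure; exact: mpre2.
have -> : fine (P1 (E1 `&` f1 @^-1` D)) = fine (nu1 mf1 D) by rewrite nu1E.
have -> : a * fine (P2 (E2 `&` f2 @^-1` D)) = fine (nu2 mf2 D).
  by rewrite nu2E fineM// fin2.
congr fine; apply: (measure_unique G (fun=> setT)) => //.
- by rewrite bigcup_const.
- move=> B GB; have mB : measurable B by rewrite Gm; exact: sub_gen_smallest.
  by rewrite nu1E nu2E -[LHS]fineK ?fin1// GE// EFinM fineK// fin2.
- by move=> _; rewrite nu1E -ge0_fin_numE// fin1.
Qed.

End scaled_measure_unique.

Section real_probability.
Context d (Y : measurableType d) (R : realType) (N : probability Y R).
Implicit Types B C : set Y.

Lemma fine_prob_ge0 B : 0 <= fine (N B). Proof. exact: fine_ge0. Qed.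

Lemma le_fine_prob B C : measurable B -> measurable C -> B `<=` C -> fine (N B) <= fine (N C).
Proof.
by move=> mB mC BC; apply: fine_le; [exact: fin_num_measure..|apply: le_measure; rewrite ?inE].
Qed.

Lemma fine_probU B C : measurable B -> measurable C -> B `&` C = set0 ->
  fine (N (B `|` C)) = fine (N B) + fine (N C).
Proof. by move=> mB mC BC; rewrite measureU// fineD//; exact: fin_num_measure. Qed.

Lemma fine_probU_le B C : measurable B -> measurable C ->
  fine (N (B `|` C)) <= fine (N B) + fine (N C).
Proof.
move=> mB mC; rewrite -fineD; [|exact: fin_num_measure..].
apply: fine_le; last exact: measureU2.
- by apply: fin_num_measure; exact: measurableU.
- by rewrite fin_numD !fin_num_measure.
Qed.

Lemma fine_prob_le1 B : measurable B -> fine (N B) <= 1.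
Proof.
move=> mB; rewrite -[1]/(fine 1%E); apply: fine_le; rewrite ?fin_num_measure//.
exact: probability_le1.
Qed.

Lemma fine_prob_eq0 B : measurable B -> (fine (N B) = 0) <-> (N B = 0%E).
Proof.
move=> mB; split=> [e|->//].
by rewrite -[LHS]fineK ?e//; exact: fin_num_measure.
Qed.

Lemma fine_probT : fine (N setT) = 1. Proof. by rewrite probability_setT. Qed.

Lemma fine_prob_split B C : measurable B -> measurable C ->
  fine (N B) = fine (N (B `&` C)) + fine (N (B `&` ~` C)).
Proof.
move=> mB mC; rewrite -fine_probU -?setIUr ?setUv ?setIT//.
- exact: measurableI.
- by apply: measurableI => //; exact: measurableC.
- by rewrite setIACA setICr !setI0.
Qed.

End real_probability.

Section approximation.
Context (R : realType) d (Y : measurableType d) (N : probability Y R).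

Definition approximable (L : set (set Y)) : set (set Y) :=
  [set D | measurable D /\ forall e : R, 0 < e ->
     exists F, [/\ L F, measurable F & fine (N (F `+` D)) < e]].

Let mY (F D : set Y) : measurable F -> measurable D -> measurable (F `+` D).
Proof. by move=> mF mD; apply: measurableU; exact: measurableD. Qed.

(** The approximable sets form a sigma-algebra.  A countable union is first
replaced by a finite one. *)
Lemma approximable_all (L G : set (set Y)) :
  L set0 -> (forall F, L F -> L (~` F)) ->
  (forall F F', L F -> L F' -> L (F `|` F')) ->
  measurable = <<s G >> -> G `<=` approximable L ->
  forall D, measurable D -> approximable L D.
Proof.
move=> L0 LC LU Gm GL.
suff : <<s G >> `<=` approximable L by move=> h D mD; apply: h; rewrite -Gm.
have aU D D' : approximable L D -> approximable L D' -> approximable L (D `|` D').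
  move=> [mD aD] [mD' aD']; split; first exact: measurableU.
  move=> e e0; have e2 : 0 < e / 2 by rewrite divr_gt0.
  have [F [LF mF Fe]] := aD _ e2; have [F' [LF' mF' Fe']] := aD' _ e2.
  exists (F `|` F'); split; [exact: LU|exact: measurableU|].
  have sub : (F `|` F') `+` (D `|` D') `<=` (F `+` D) `|` (F' `+` D').
    by move=> z /=; tauto.
  apply: le_lt_trans (le_fine_prob N _ _ sub) _.
  - by apply: mY; exact: measurableU.
  - by apply: measurableU; exact: mY.
  apply: le_lt_trans (fine_probU_le N _ _) _; [exact: mY..|].
  by rewrite [e]splitr ltrD.
apply: smallest_sub => //; split.
- split=> // e e0; exists set0; split=> //.
  by rewrite /setY set0D setU0 measure0.
- move=> D [mD aD]; rewrite setTD; split; first exact: measurableC.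
  move=> e /aD[F [LF mF Fe]]; exists (~` F); split=> //; [exact: LC|exact: measurableC|].
  rewrite (_ : ~` F `+` ~` D = F `+` D)//.
  by apply/seteqP; split=> z /=; have := EM (F z); have := EM (D z); tauto.
- move=> D aD; have mD k : measurable (D k) by have [] := aD k.
  have mUD : measurable (\bigcup_k D k) by exact: bigcup_measurable.
  split=> // e e0; have e2 : 0 < e / 2 by rewrite divr_gt0.
  (* Spend e / 2 on truncating the union, and e / 2 on approximating B n. *)
  pose B n := \big[setU/set0]_(i < n) D i.
  have aB n : approximable L (B n).
    elim: n => [|n IHn].
      rewrite /B big_ord0; split=> // e' e'0; exists set0; split=> //.
      by rewrite /setY setDv setU0 measure0.
    by rewrite /B big_ord_recr; exact: aU.
  have mB n : measurable (B n) by have [] := aB n.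
  have BU : \bigcup_n B n = \bigcup_k D k.
    apply/seteqP; split=> [z [n _]|z [k _ Dz]]; first exact: bigsetU_bigcup.
    by exists k.+1 => //; rewrite /B big_ord_recr; right.
  have ndB : nondecreasing_seq B.
    apply/nondecreasing_seqP => n; apply/subsetPset.
    by rewrite [B n.+1]big_ord_recr; exact: subsetUl.
  have : (fine (N (B n)) @[n --> \oo] --> fine (N (\bigcup_k D k))).
    apply: fine_cvg; rewrite fineK; last exact: fin_num_measure.
    by rewrite -BU; apply: nondecreasing_cvg_mu => //; rewrite BU.
  move=> /cvgr_dist_lt /(_ _ e2)[n _ /(_ n (leqnn n))] /= dn.
  have sBD : B n `<=` \bigcup_k D k by exact: bigsetU_bigcup.
  have [_ /(_ _ e2)[F [LF mF Fe]]] := aB n.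
  exists F; split=> //.
  have sub : F `+` \bigcup_k D k `<=` (F `+` B n) `|` (\bigcup_k D k `&` ~` B n).
    by move=> z /=; have := EM (B n z); have := sBD z; rewrite /=; tauto.
  have mDB : measurable (\bigcup_k D k `&` ~` B n).
    by apply: measurableI => //; exact: measurableC.
  apply: le_lt_trans (le_fine_prob N _ _ sub) _.
  - exact: mY.
  - by apply: measurableU => //; exact: mY.
  apply: le_lt_trans (fine_probU_le N _ _) _; [exact: mY|by []|].
  rewrite [e]splitr ltrD//; apply: le_lt_trans dn.
  rewrite (fine_prob_split N mUD (mB n)) (setIidr sBD).
  by rewrite addrC addKr ler_norm.
Qed.

End approximation.

Lemma ge0_integral_eq0P (R : realType) d (Y : measurableType d)
    (mu : {measure set Y -> \bar R}) (f : Y -> \bar R) :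
  measurable_fun setT f -> (forall y, 0 <= f y)%E ->
  (\int[mu]_y f y = 0)%E <-> mu [set y | f y != 0%E] = 0%E.
Proof.
move=> mf f0.
have mN : measurable [set y | f y != 0%E].
  by rewrite -[X in measurable X]setTI; exact: emeasurable_neq.
have <- : (\int[mu]_y `|f y| = \int[mu]_y f y)%E.
  by apply: eq_integral => y _; rewrite gee0_abs.
split.
- move/(ae_eq_integral_abs mu measurableT mf) => [Z [mZ Z0 sZ]].
  apply/eqP; rewrite eq_le measure_ge0 andbT.
  have : (mu [set y | f y != 0] <= mu Z)%E.
    apply: le_measure; rewrite ?inE// => y /= fy; apply: sZ => /= /(_ I) fy0.
    by rewrite fy0 eqxx in fy.
  by rewrite Z0.
- move=> Z0; apply/(ae_eq_integral_abs mu measurableT mf).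
  exists [set y | f y != 0%E]; split=> // y /=.
  by apply: contra_not_neq => -> _.
Qed.

Lemma null_ysection (R : realType) d1 (X : measurableType d1) d2 (W : measurableType d2)
    (mu : probability X R) (P : probability W R) (Z : set (X * W)) : measurable Z ->
  (mu \x P)%E Z = 0%E <-> P [set w | mu (ysection Z w) != 0%E] = 0%E.
Proof.
move=> mZ.
have -> : (mu \x P)%E Z = (\int[P]_w mu (ysection Z w))%E.
  rewrite -[RHS]/((mu \x^ P)%E Z).
  by apply: product_measure_unique => // B V mB mV; exact: product_measure2E.
by apply: ge0_integral_eq0P => //; exact: measurable_fun_ysection.
Qed.

Section nonsingular_product.
Context (R : realType) dX (X : measurableType dX) (mu : probability X R).
Context dW (W : measurableType dW) (P : probability W R).
Variables (q : X -> X) (s : W -> W).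
Hypotheses (mq : measurable_fun setT q) (ms : measurable_fun setT s).
Hypothesis s_inv : forall B, measurable B -> P (s @^-1` B) = P B.

Let qs (z : X * W) := (q z.1, s z.2).

Lemma measurable_pair_map : measurable_fun setT qs.
Proof.
by apply: measurable_fun_pair; [exact: measurableT_comp|exact: measurableT_comp].
Qed.

(** Since s preserves P, the W-section above x of the preimage has the same
measure as the section of D above q x. *)
Lemma product_measure_map D : measurable D ->
  (mu \x P)%E (qs @^-1` D) = (\int[mu]_x P (xsection D (q x)))%E.
Proof.
move=> mD; rewrite /product_measure1; apply: eq_integral => x _ /=.
rewrite -[RHS]s_inv; last exact: measurable_xsection.
by congr (P _); apply/seteqP; split=> w /=; rewrite /xsection /= !inE.
Qed.

Lemma nonsingular_product D :
  (forall B, measurable B -> mu B = 0%E -> mu (q @^-1` B) = 0%E) ->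
  measurable D -> (mu \x P)%E D = 0%E -> (mu \x P)%E (qs @^-1` D) = 0%E.
Proof.
move=> nsq mD.
have mg := measurable_fun_xsection P mD.
have mgq : measurable_fun setT ((P \o xsection D) \o q) by exact: measurableT_comp.
move/(ge0_integral_eq0P mu mg (fun=> measure_ge0 _ _)) => D0.
rewrite product_measure_map//.
apply/(ge0_integral_eq0P mu mgq (fun=> measure_ge0 _ _)).
apply: (nsq _ _ D0).
by rewrite -[X in measurable X]setTI; exact: emeasurable_neq.
Qed.

End nonsingular_product.

(** * A maximal inequality for ratios of orbit sums *)

Section transfer_density.
Context d (Y : measurableType d) (R : realType) (N : probability Y R).
Variables T T' : Y -> Y.
Hypotheses (mT : measurable_fun setT T) (mT' : measurable_fun setT T').
Hypotheses (T'K : cancel T' T).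
Hypothesis nsT : forall B, measurable B -> N B = 0%E -> N (T' @^-1` B) = 0%E.

(** The density w of B |-> N (T B) with respect to N, stated as a change of
variables for real functions.  The image T B is written [T' @^-1` B], where T'
is the inverse of T. *)
Lemma transfer_density : exists w : Y -> R,
  [/\ forall z, 0 <= w z,
      forall g : Y -> R, N.-integrable setT (EFin \o g) ->
        N.-integrable setT (EFin \o (fun z => w z * g (T z))) &
      forall (g : Y -> R) C, N.-integrable setT (EFin \o g) -> measurable C ->
        \int[N]_(z in C) (w z * g (T z)) = \int[N]_(z in T' @^-1` C) g z].
Proof.
pose mix := isMeasurableFun.Build _ _ _ _ _ mT'.
pose X : {mfun Y >-> Y} := HB.pack T' mix.
pose nu := distribution N X.
have numu : nu `<< N.
  by apply/null_content_dominatesP => A mA NA; apply: nsT.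
pose f := Radon_Nikodym_SigmaFinite.f nu N.
have f0 : forall z, (0 <= f z)%E by apply: Radon_Nikodym_SigmaFinite.f_ge0.
have ffin : forall z, f z \is a fin_num by apply: Radon_Nikodym_SigmaFinite.f_fin_num.
have fint : N.-integrable setT f by apply: Radon_Nikodym_SigmaFinite.f_integrable.
pose w z := fine (f z).
have wE (g : Y -> R) : EFin \o (fun z => w z * g (T z)) = (fun z => (EFin \o (g \o T)) z * f z)%E.
  by apply/funext => z /=; rewrite -[f z]fineK// -EFinM mulrC.
have nuint (g : Y -> R) : N.-integrable setT (EFin \o g) ->
    nu.-integrable setT (EFin \o (g \o T)).
  move=> ig; apply: integrable_pushforward => //.
    by apply/measurable_EFinP/measurableT_comp => //; apply/measurable_EFinP/(measurable_int N).
  rewrite (_ : _ \o _ = EFin \o g)//.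
  by apply/funext => z /=; rewrite T'K.
have wint (g : Y -> R) : N.-integrable setT (EFin \o g) ->
        N.-integrable setT (EFin \o (fun z => w z * g (T z))).
  move=> ig; rewrite wE.
  have /integrable_abse ia := nuint _ ig.
  have := @Radon_Nikodym_SigmaFinite.integrableM _ _ _ nu N numu _ setT
     (fun z => abse_ge0 ((EFin \o (g \o T)) z)) measurableT ia.
  apply: le_integrable => //.
    apply: emeasurable_funM; last exact: measurable_int fint.
    by apply/measurable_EFinP/measurableT_comp => //; apply/measurable_EFinP/(measurable_int N).
  by move=> z _; rewrite !abseM abse_id.
exists w; split => //.
- by move=> z; apply: fine_ge0.
- move=> g C ig mC; congr fine.
  have -> : (\int[N]_(x in C) (w x * g (T x))%:E)%E =
    (\int[N]_(x in C) ((EFin \o (g \o T)) x * f x))%E.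
    by have := wE g => /(congr1 (fun h => \int[N]_(x in C) h x)%E).
  transitivity (\int[N]_(x in C) ((EFin \o (g \o T)) x *
      Radon_Nikodym (charge_of_finite_measure nu) N x))%E.
    have mg : measurable_fun C (EFin \o (g \o T)).
      apply: measurable_funTS.
      by apply/measurable_EFinP/measurableT_comp => //; apply/measurable_EFinP/(measurable_int N).
    apply: ae_eq_integral => //.
    - apply: emeasurable_funM => //.
      by apply: measurable_funTS; exact: measurable_int fint.
    - apply: emeasurable_funM => //; exact: measurable_funTS.
    - by apply: ae_eqe_mul2l; exact: ae_eq_Radon_Nikodym_SigmaFinite.
  rewrite Radon_Nikodym_change_of_variables//; last first.
    by apply: (integrableS measurableT) => //; exact: nuint.
  rewrite integral_pushforward//.
  + by apply: eq_integral => z _ /=; rewrite T'K.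
  + by apply/measurable_EFinP/measurableT_comp => //; apply/measurable_EFinP/(measurable_int N).
  + rewrite (_ : _ \o _ = EFin \o g); last by apply/funext => z /=; rewrite T'K.
    apply: (integrableS measurableT) => //.
    by rewrite -[X in measurable X]setTI; exact: mT'.
Qed.

End transfer_density.

Section ratio_maximal_inequality.
Context d (Y : measurableType d) (R : realType) (N : probability Y R).
Variables T T' : Y -> Y.
Hypotheses (mT : measurable_fun setT T) (mT' : measurable_fun setT T').
Hypotheses (T'K : cancel T' T).
Hypothesis nsT : forall B, measurable B -> N B = 0%E -> N (T' @^-1` B) = 0%E.

(** The maximal ergodic theorem for the positive operator g |-> w (g o T), in
Garsia's form, applied to h = 1_H - e.  The functions M n are the running maxima
of 0 and the orbit sums S n; on the set where M n.+1 is positive it equals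
h + w (M n o T), and the operator preserves integrals, so h has nonnegative
integral there.  Off the union E of these sets every S n is nonpositive, and
integrating S n over C gives the inequality between sums.  Here
[iter k T' @^-1` C] is T^k C. *)
Lemma ratio_maximal_inequality (H : set Y) (e : R) : measurable H -> 0 < e ->
  exists E, [/\ measurable E, e * fine (N E) <= fine (N H) &
    forall C n, measurable C -> C `<=` ~` E ->
     \sum_(k < n) fine (N ((iter k T' @^-1` C) `&` H)) <=
     e * \sum_(k < n) fine (N (iter k T' @^-1` C))].
Proof.
move=> mH e0.
have [w [w0 wint wE]] := transfer_density mT mT' T'K nsT.
pose h z : R := \1_H z - e.
have ih : N.-integrable setT (EFin \o h).
  rewrite (_ : _ \o _ = (EFin \o \1_H) \- (EFin \o cst e))%E//.
  apply: integrableB => //.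
    by apply: integrable_indic => //; rewrite (le_lt_trans (probability_le1 _ _))// ltry.
  exact: finite_measure_integrable_cst.
pose S n := iter n (fun (g : Y -> R) z => h z + w z * g (T z)) (fun=> 0).
pose M n := iter n (fun (g : Y -> R) z => Num.max 0 (h z + w z * g (T z))) (fun=> 0).
have istep g : N.-integrable setT (EFin \o g) ->
    N.-integrable setT (EFin \o (fun z => h z + w z * g (T z))).
  move=> ig; rewrite (_ : _ \o _ = (EFin \o h) \+ (EFin \o (fun z => (w z * g (T z))%R)))%E//.
  by apply: integrableD => //; exact: wint.
have iS n : N.-integrable setT (EFin \o S n).
  elim: n => [|n IHn]; first exact: integrable0.
  exact: istep.
have iM n : N.-integrable setT (EFin \o M n).
  elim: n => [|n IHn]; first exact: integrable0.
  have i1 := istep _ IHn.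
  apply: le_integrable i1 => //=.
    apply/measurable_EFinP; apply: measurable_maxr => //.
    exact/measurable_EFinP/(measurable_int N)/(istep _ IHn).
  move=> z _; rewrite lee_fin.
  case: (lerP 0 (h z + w z * M n (T z))) => [a0|a0].
    by rewrite ger0_norm.
  by rewrite normr0.
have ME n z : M n.+1 z = Num.max 0 (h z + w z * M n (T z)) by [].
have M0 n z : 0 <= M n z.
  by case: n => [|n] //=; rewrite le_max lexx.
have MM n z : M n z <= M n.+1 z.
  elim: n z => [|n IHn] z; first exact: M0.
  by rewrite /= ge_max le_max lexx/= le_max lerD2l ler_wpM2l ?orbT// IHn.
have SM n z : S n z <= M n z.
  elim: n z => [|n IHn] z //=.
  by rewrite le_max lerD2l ler_wpM2l ?orbT.
pose E n := [set z | 0 < M n z].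
have mE n : measurable (E n).
  rewrite (_ : E n = M n @^-1` `]0, +oo[%classic).
    rewrite -[X in measurable X]setTI.
    by apply: (measurable_EFinP _ _).1 => //; exact: (measurable_int N).
  by apply/seteqP; split=> z; rewrite /E /= in_itv/= andbT.
have fN A : measurable A -> N A \is a fin_num by move=> mA; exact: fin_num_measure.
have intindic A C : measurable A -> measurable C -> \int[N]_(z in C) \1_A z = fine (N (C `&` A)).
  by move=> mA mC; rewrite /Rintegral integral_indic// setIC.
have iindic A C : measurable A -> measurable C -> N.-integrable C (EFin \o (\1_A : Y -> R)).
  move=> mA mC; apply: (integrableS measurableT) => //.
  by apply: integrable_indic => //; rewrite (le_lt_trans (probability_le1 _ _))// ltry.
have inth C : measurable C -> \int[N]_(z in C) h z = fine (N (C `&` H)) - e * fine (N C).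
  move=> mC; rewrite RintegralB//; last 2 first.
  - exact: iindic.
  - by apply: (integrableS measurableT) => //; exact: finite_measure_integrable_cst.
  by rewrite intindic// Rintegral_cst.
have iC g C : N.-integrable setT (EFin \o g) -> measurable C -> N.-integrable C (EFin \o g).
  by move=> ig mC; apply: (integrableS measurableT).
(* Garsia's estimate. *)
have hE n : 0 <= \int[N]_(z in E n) h z.
  case: n => [|n].
    rewrite (_ : E 0%N = set0) ?Rintegral_set0//.
    by apply/seteqP; split=> z //; rewrite /E/= ltxx.
  have -> : \int[N]_(z in E n.+1) h z =
      \int[N]_(z in E n.+1) (M n.+1 z - w z * M n (T z)).
    apply: eq_Rintegral => z; rewrite inE => zE; have : 0 < M n.+1 z := zE; rewrite ME.
    by case: (lerP 0 (h z + w z * M n (T z))) => [_ _|_]; rewrite ?ltxx// addrK.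
  rewrite RintegralB//; [|exact: iC|by apply: iC => //; exact: wint].
  have -> : \int[N]_(z in E n.+1) M n.+1 z = \int[N]_z M n.+1 z.
    rewrite Rintegral_mkcond; apply: eq_Rintegral => z _.
    rewrite patchE; case: ifPn => //; rewrite notin_setE /E /= => /negP.
    by rewrite -leNgt => l0; apply/eqP; rewrite eq_le l0 (M0 n.+1).
  rewrite subr_ge0; apply: (@le_trans _ _ (\int[N]_z M n z)); last first.
    by apply: le_Rintegral => // z _; exact: MM.
  have := wE (M n) setT (iM n) measurableT; rewrite preimage_setT => <-.
  rewrite Rintegral_mkcond; apply: le_Rintegral => //.
  - rewrite -restrict_EFin; apply/(integrable_mkcond (EFin \o (fun z => w z * M n (T z))) (mE n.+1)).
    by apply: (iC (fun z => w z * M n (T z))) => //; exact: wint.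
  - exact: wint.
  - by move=> z _; rewrite patchE; case: ifPn => // _; rewrite mulr_ge0.
exists (\bigcup_n E n); split.
- exact: bigcup_measurable.
- have cE : fine (N (E n)) @[n --> \oo] --> fine (N (\bigcup_n E n)).
    apply: fine_cvg; rewrite fineK; last by apply: fN; exact: bigcup_measurable.
    apply: nondecreasing_cvg_mu => //; first exact: bigcup_measurable.
    apply/nondecreasing_seqP => n; apply/subsetPset => z; rewrite /E/= => /lt_le_trans; apply.
    exact: MM.
  have : e * fine (N (E n)) @[n --> \oo] --> e * fine (N (\bigcup_n E n)).
    exact: cvgMr.
  move/cvgr_to_le; apply.
  apply: nearW => n; have := hE n; rewrite inth// subr_ge0 => /le_trans; apply.
  apply: fine_le; [by apply: fN; exact: measurableI|exact: fN|].
  by apply: le_measure; rewrite ?inE//; exact: measurableI.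
- move=> C n mC CE.
  have intS m D : measurable D -> \int[N]_(z in D) S m z =
     \sum_(k < m) fine (N ((iter k T' @^-1` D) `&` H))
      - e * \sum_(k < m) fine (N (iter k T' @^-1` D)).
    elim: m D => [|m IHm] D mD.
      by rewrite !big_ord0 mulr0 subr0 Rintegral_cst// mul0r.
    have mT'D : measurable (T' @^-1` D) by rewrite -[X in measurable X]setTI; exact: mT'.
    have -> : \int[N]_(z in D) S m.+1 z = \int[N]_(z in D) h z + \int[N]_(z in D) (w z * S m (T z)).
      by rewrite RintegralD//; [exact: iC|apply: (iC (fun z => w z * S m (T z))) => //; exact: wint].
    rewrite inth// wE// IHm// !big_ord_recl.
    have -> : \sum_(i < m) fine (N (iter (lift ord0 i) T' @^-1` D `&` H)) =
      \sum_(i < m) fine (N (iter i T' @^-1` (T' @^-1` D) `&` H)) by [].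
    have -> : \sum_(i < m) fine (N (iter (lift ord0 i) T' @^-1` D)) =
      \sum_(i < m) fine (N (iter i T' @^-1` (T' @^-1` D))) by [].
    have -> : iter (ord0 : 'I_m.+1) T' @^-1` D = D by [].
    by ring.
  rewrite -subr_le0 -intS//.
  rewrite -oppr_ge0 -mulN1r -RintegralZl//; last exact: iC.
  apply: Rintegral_ge0 => z Cz; rewrite mulN1r oppr_ge0 (le_trans (SM _ _))// leNgt.
  apply/negP => MZ; apply: (CE z Cz); exists n => //.
Qed.

End ratio_maximal_inequality.

(** * Conservativity and divergence of orbit sums *)

Section recurrence.
Context (R : realType) d (Y : measurableType d) (N : probability Y R).
Variable U : int -> Y -> Y.

(** The set [U (- k) @^-1` D] is the forward image U_k D, so that the sum is the
integral over D of the first n densities of the action.  Forward images are the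
ones that matter, because the marginals are controlled at positive sites. *)
Definition divergent_orbits : Prop :=
  forall D, measurable D -> 0 < fine (N D) -> forall M : R,
    exists n : nat, M < \sum_(k < n) fine (N (U (- k%:Z) @^-1` D)).

(** Otherwise Borel-Cantelli shows that almost every point was in D only finitely
often in the past.  Every point of D then lies in the orbit of D', the set of
points of D that have no earlier visit to D.  So D' has positive measure; but
no orbit meets D' twice, which conservativity forbids. *)
Lemma conservative_divergent :
  is_Zaction U -> (forall n, measurable_fun setT (U n)) ->
  (forall n B, measurable B -> N B = 0%E -> N (U n @^-1` B) = 0%E) ->
  conservative N U -> divergent_orbits.
Proof.
move=> [U0 UD] mU nsU cU D mD D0 M; apply: contrapT => /forallNP bound.
have UU n k z : U n (U k z) = U (n + k) z by rewrite UD.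
pose F k := U (- k%:Z) @^-1` D.
have mF k : measurable (F k) by exact: measurable_preimage.
have F0 : F 0%N = D by rewrite /F oppr0 U0.
have limF : N (lim_sup_set F) = 0%E.
  apply: lim_sup_set_cvg0 => //; apply: (@le_lt_trans _ _ M%:E); last exact: ltry.
  apply: lime_le; first by apply: is_cvg_nneseries.
  apply: nearW => n; rewrite big_mkord.
  have -> : (\sum_(i < n) N (F i) = (\sum_(i < n) fine (N (F i)))%:E)%E.
    rewrite -sumEFin; apply: eq_bigr => i _; rewrite fineK//; exact: fin_num_measure.
  by rewrite lee_fin leNgt; exact/negP/bound.
(* D' consists of the points that visit D for the first time. *)
pose D' := D `&` \bigcap_(k in [set k | (0 < k)%N]) ~` F k.
have mD' : measurable D'.
  by apply: measurableI => //; apply: bigcap_measurableType => k _; exact: measurableC.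
have cover : D `<=` lim_sup_set F `|` \bigcup_k (U (- k%:Z) @^-1` D').
  move=> z Dz; have [|nz] := pselect (lim_sup_set F z); [by left|right].
  have [n nF] : exists n, forall j, (n <= j)%N -> ~ F j z.
    apply: contrapT => /forallNP h; apply: nz => n _.
    by have /existsNP[j /not_implyP[nj /contrapT Fj]] := h n; exists j.
  pose K k := `[< F k z >].
  have K0 : exists k, K k by exists 0%N; apply/asboolP; rewrite F0.
  have Kn k : K k -> (k <= n)%N.
    by move/asboolP => Fk; rewrite leqNgt; apply/negP => /ltnW /nF.
  (* k is the time elapsed since the first visit. *)
  case: (ex_maxnP K0 Kn) => k /asboolP Fk kmax; exists k => //; split=> // j /= j0.
  rewrite /F /= UU => Fjk.
  have : K (j + k)%N by apply/asboolP; rewrite /F /= PoszD opprD.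
  by move/kmax; rewrite -{2}[k]add0n leq_add2r leqNgt j0.
have D'0 : N D' <> 0%E.
  move=> D'0; have nul : N (lim_sup_set F `|` \bigcup_k (U (- k%:Z) @^-1` D')) = 0%E.
    have mU' k : measurable (U (- k%:Z) @^-1` D') by exact: measurable_preimage.
    rewrite measureU0//.
    - by apply: bigcap_measurableType => n _; exact: bigcup_measurable.
    - exact: bigcup_measurable.
    - apply/negligibleP; first exact: bigcup_measurable.
      apply: negligible_bigcup => k.
      by apply/negligibleP => //; exact: nsU.
  have : fine (N D) <= fine (N (lim_sup_set F `|` \bigcup_k (U (- k%:Z) @^-1` D'))).
    apply: le_fine_prob => //; apply: measurableU.
      by apply: bigcap_measurableType => n _; exact: bigcup_measurable.
    by apply: bigcup_measurable => k _; exact: measurable_preimage.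
  by rewrite nul leNgt D0.
have wander z n : D' z -> D' (U n z) -> n = 0.
  move=> [Dz nDz] [DUz nDUz]; case: n DUz nDUz => [[|n]|n] // DUz nDUz.
    by exfalso; apply: (nDUz n.+1) => //; rewrite /F /= UU addNr U0.
  by exfalso; apply: (nDz n.+1) => //; rewrite /F /= -NegzE.
have D'pos : (0 < N D')%E by rewrite lt0e measure_ge0 andbT; exact/eqP.
have [Z [mZ Z0 sZ]] := cU D' mD' D'pos.
apply: D'0; apply/eqP; rewrite eq_le measure_ge0 andbT.
have : (N D' <= N Z)%E; last by rewrite Z0.
apply: le_measure; rewrite ?inE// => z D'z; apply: sZ => /= /(_ D'z); apply.
apply: (@sub_finite_set _ _ [set 0]); last exact: finite_set1.
by move=> n /= /(wander _ _ D'z).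
Qed.

End recurrence.

Section product_recurrence.
Context (R : realType) dX (X : measurableType dX) (mu : probability X R).
Context dW (W : measurableType dW) (P : probability W R).
Variables (Q : int -> X -> X) (S : int -> W -> W).
Hypotheses (mQ : forall n, measurable_fun setT (Q n)).
Hypotheses (mS : forall n, measurable_fun setT (S n)).

(** The second factor preserves its measure, so N (U_k C) is the integral of
g o Q_(-k), where g x is the mass of the section of C above x.  This is at least
e times the mass of Q_k D, where D is the set on which g exceeds e. *)
Lemma product_divergent : measure_preserving P S ->
  divergent_orbits mu Q -> divergent_orbits (mu \x P)%E (prod_action Q S).
Proof.
move=> PS dQ C mC C0 M.
pose N : probability (X * W)%type R := (mu \x P)%E.
pose g x := P (xsection C x).
have mg : measurable_fun setT g := measurable_fun_xsection P mC.
pose e := fine (N C) / 2; have e0 : 0 < e by rewrite divr_gt0.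
pose D := [set x | (e%:E < g x)%E].
have mD : measurable D by rewrite -[D]setTI; exact: emeasurable_fun_o_infty.
have g1 x : (g x <= 1)%E by apply: probability_le1; exact: measurable_xsection.
(* g is at most 1, so N C <= mu D + e, and e is half of N C. *)
have D0 : 0 < fine (mu D).
  have : (N C <= mu D + e%:E)%E.
    have -> : N C = (\int[mu]_x g x)%E by [].
    have -> : (mu D + e%:E = \int[mu]_x ((\1_D x)%:E + e%:E))%E.
      have mI : measurable_fun setT (fun x => (\1_D x)%:E : \bar R).
        exact/measurable_EFinP.
      rewrite ge0_integralD//; last by move=> x _; rewrite lee_fin ltW.
      rewrite integral_indic// setIT integral_cst//.
      by rewrite [X in (_ * X)%E](@probability_setT _ _ _ mu) mule1.
    apply: ge0_le_integral => //.
    - by apply: emeasurable_funD => //; exact/measurable_EFinP.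
    - move=> x _; rewrite indicE; have [xD|xD] := boolP (x \in _).
        by apply: (le_trans (g1 x)); rewrite leeDl// lee_fin ltW.
      by rewrite add0e leNgt; move: xD; rewrite notin_setE => /negP.
  have fC : N C \is a fin_num by exact: fin_num_measure.
  have fD : mu D \is a fin_num by exact: fin_num_measure.
  rewrite -[N C]fineK// -[mu D]fineK// -EFinD lee_fin => h.
  by move: h; rewrite {1}[fine (N C)]splitr -/e lerD2r; apply: lt_le_trans.
have step k : e * fine (mu (Q k @^-1` D)) <= fine (N (prod_action Q S k @^-1` C)).
  have fC : N (prod_action Q S k @^-1` C) \is a fin_num.
    by apply: fin_num_measure; apply: measurable_preimage => //; exact: measurable_pair_map.
  have mQD : measurable (Q k @^-1` D) by exact: measurable_preimage.
  rewrite -lee_fin [leRHS]fineK// EFinM fineK; last exact: fin_num_measure.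
  have -> : N (prod_action Q S k @^-1` C) = (\int[mu]_x g (Q k x))%E.
    by apply: product_measure_map => // B mB; exact: PS.
  have -> : (e%:E * mu (Q k @^-1` D) = \int[mu]_x (e%:E * (\1_(Q k @^-1` D) x)%:E))%E.
    rewrite ge0_integralZl//; last 2 first.
    - exact/measurable_EFinP.
    - by rewrite lee_fin ltW.
    by rewrite integral_indic// setIT.
  apply: ge0_le_integral => //.
  - by move=> x _; rewrite mule_ge0 ?lee_fin// ltW.
  - by apply: measurable_funeM; exact/measurable_EFinP.
  - exact: measurableT_comp.
  - move=> x _; rewrite indicE; have [xD|xD] := boolP (x \in _).
      by rewrite mule1; move: xD; rewrite inE => /ltW.
    by rewrite mule0 measure_ge0.
have [n nM] := dQ D mD D0 (M / e); exists n.
move: nM; rewrite ltr_pdivrMr// => /lt_le_trans; apply.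
by rewrite mulrC mulr_sumr; apply: ler_sum => k _; exact: step.
Qed.

End product_recurrence.

(** * Random variables with finitely many values *)

Section finite_factor.
Context d (Y : measurableType d) (R : realType) (N : probability Y R).
Variables (T : finType) (g : Y -> T).
Hypothesis mg : forall t, measurable (g @^-1` [set t]).
Implicit Types (phi : T -> R) (D : set Y).

Let phiE phi : EFin \o (phi \o g) =
  (fun y => \sum_(t : T) (phi t)%:E * (\1_(g @^-1` [set t]) y)%:E)%E.
Proof.
apply/funext => y /=; rewrite (bigD1 (g y))//= indicE mem_set// mule1.
rewrite big1 ?adde0// => t tg; rewrite indicE memNset ?mule0//.
by move=> /= gt; rewrite gt eqxx in tg.
Qed.

Let itg phi t D : measurable D ->
  N.-integrable D (fun y => (phi t)%:E * (\1_(g @^-1` [set t]) y)%:E)%E.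
Proof.
move=> mD; apply: integrableZl => //; apply: (integrableS measurableT) => //.
by apply: integrable_indic => //; rewrite (le_lt_trans (probability_le1 _ _)) ?ltry.
Qed.

Lemma integrable_factor phi D : measurable D -> N.-integrable D (EFin \o (phi \o g)).
Proof. by move=> mD; rewrite phiE; apply: integrable_sum => // t _; exact: itg. Qed.

(** A function of a random element with finitely many values is integrated by
summing over these values. *)
Lemma Rintegral_factor phi D : measurable D ->
  \int[N]_(y in D) phi (g y) = \sum_(t : T) phi t * fine (N (D `&` g @^-1` [set t])).
Proof.
move=> mD; rewrite /Rintegral.
have -> : (\int[N]_(y in D) (phi (g y))%:E = \int[N]_(y in D) (EFin \o (phi \o g)) y)%E by [].
rewrite phiE integral_sum//; last by move=> t; exact: itg.
transitivity (fine (\sum_(t : T) (phi t * fine (N (D `&` g @^-1` [set t])))%:E)%E);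
  last by rewrite sumEFin.
congr fine; apply: eq_bigr => t _.
rewrite integralZl//; last first.
  apply: (integrableS measurableT) => //.
  by apply: integrable_indic => //; rewrite (le_lt_trans (probability_le1 _ _)) ?ltry.
rewrite integral_indic// setIC EFinM fineK//.
by apply: fin_num_measure; exact: measurableI.
Qed.

Lemma sum_fibers D : measurable D ->
  \sum_(t : T) fine (N (D `&` g @^-1` [set t])) = fine (N D).
Proof.
move=> mD; have := Rintegral_factor (fun=> 1) mD.
by rewrite Rintegral_cst// mul1r => ->; apply: eq_bigr => t _; rewrite mul1r.
Qed.

End finite_factor.

Section simple_variables.
Context d (Y : measurableType d) (R : realType) (N : probability Y R).
Implicit Types (f : Y -> R) (D : set Y).

(** The finite type and the map to it are kept abstract, so that sums and
products of simple variables are simple by pairing the underlying maps. *)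
Definition simple_variable f : Prop := exists (T : finType) (g : Y -> T)
  (phi : T -> R), (forall t, measurable (g @^-1` [set t])) /\ f = phi \o g.

Lemma simple_variable_op (op : R -> R -> R) f1 f2 : simple_variable f1 ->
  simple_variable f2 -> simple_variable (fun y => op (f1 y) (f2 y)).
Proof.
move=> [T1 [g1 [phi1 [mg1 ->]]]] [T2 [g2 [phi2 [mg2 ->]]]].
exists (T1 * T2)%type, (fun y => (g1 y, g2 y)), (fun t => op (phi1 t.1) (phi2 t.2)).
split=> // -[t1 t2]; rewrite (_ : _ @^-1` _ = g1 @^-1` [set t1] `&` g2 @^-1` [set t2]).
  exact: measurableI.
by apply/seteqP; split=> y /= [-> ->].
Qed.

Lemma simple_variable_cst r : simple_variable (fun=> r).
Proof.
exists unit, (fun=> tt), (fun=> r); split=> // -[].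
by rewrite (_ : _ @^-1` _ = setT)//; apply/seteqP; split.
Qed.

Lemma simple_variable_sum (I : Type) (s : seq I) (f : I -> Y -> R) :
  (forall i, simple_variable (f i)) -> simple_variable (fun y => \sum_(i <- s) f i y).
Proof.
move=> sf; elim: s => [|i s IHs].
  by under eq_fun do rewrite big_nil; exact: simple_variable_cst.
by under eq_fun do rewrite big_cons; exact: simple_variable_op.
Qed.

Lemma simple_variable_integrable f D : measurable D -> simple_variable f ->
  N.-integrable D (EFin \o f).
Proof. by move=> mD [T [g [phi [mg ->]]]]; exact: integrable_factor. Qed.

Lemma Rintegral_simple_sum (I : Type) (s : seq I) (f : I -> Y -> R) D :
  measurable D -> (forall i, simple_variable (f i)) ->
  \int[N]_(y in D) (\sum_(i <- s) f i y) = \sum_(i <- s) \int[N]_(y in D) f i y.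
Proof.
move=> mD sf; elim: s => [|i s IHs].
  rewrite big_nil; under eq_Rintegral do rewrite big_nil.
  by rewrite Rintegral_cst// mul0r.
rewrite big_cons -IHs -RintegralD//; last 2 first.
- exact: simple_variable_integrable.
- by apply: simple_variable_integrable => //; exact: simple_variable_sum.
by under eq_Rintegral do rewrite big_cons.
Qed.

End simple_variables.

(** * Product measures seen through coordinates *)

(** An identification of X with the configurations on the set J of sites.  It is
kept apart from the type of X so that A^Z, with sites int, and (A^Z)^p, with
sites 'I_p * int, are covered by one argument. *)
Record coordinates d (A : measurableType d) dX (X : measurableType dX)
    (J : Type) := Coordinates {
  coord :> X -> J -> A;
  point_of : (J -> A) -> X;
  point_ofK : cancel point_of coord;
  coordK : cancel coord point_of;
  measurable_coordE : @measurable dX X =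
    <<s \bigcup_(j in [set: J])
      preimage_set_system setT (fun x => coord x j) measurable >> }.

Section cylinders.
Context d (A : finMeasurableType d) (mA : forall B : set A, measurable B).
Context dX (X : measurableType dX) (J : countType) (c : coordinates A X J).
Implicit Types (s t : seq J) (v p q : J -> A).

Definition cyl s v : set X := [set x | forall j, j \in s -> c x j = v j].

(** The empty set is added to make the class closed under intersections: two
cylinders whose words disagree on a common site do not meet. *)
Definition cyl_sets : set (set X) :=
  [set D | D = set0 \/ exists s v, D = cyl s v].

Definition upd s q (x : X) : X :=
  point_of c (fun j => if j \in s then q j else c x j).

Lemma coord_upd s q x j : c (upd s q x) j = if j \in s then q j else c x j.
Proof. by rewrite /upd point_ofK. Qed.

Lemma coord_inj x y : (forall j, c x j = c y j) -> x = y.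
Proof. by move=> /funext xy; rewrite -(coordK c x) xy coordK. Qed.

Lemma cyl_nil v : cyl [::] v = setT.
Proof. exact/seteqP. Qed.

Lemma cyl_cat s t v : cyl (s ++ t) v = cyl s v `&` cyl t v.
Proof.
apply/seteqP; split=> x /=.
  by move=> xs; split=> j js; apply: xs; rewrite mem_cat js ?orbT.
by case=> xs xt j; rewrite mem_cat => /orP[/xs|/xt].
Qed.

Lemma cyl_cons j s v : cyl (j :: s) v = cyl [:: j] v `&` cyl s v.
Proof. by rewrite -cat1s cyl_cat. Qed.

Lemma eq_cyl s t v u : s =i t -> {in s, v =1 u} -> cyl s v = cyl t u.
Proof.
move=> st vu; apply/seteqP; split=> x /= xs j.
  by rewrite -st => js; rewrite xs// vu.
by move=> js; rewrite xs ?vu// -st.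
Qed.

Lemma measurable_coord j (B : set A) : measurable [set x | B (c x j)].
Proof.
rewrite (measurable_coordE c); apply: sub_gen_smallest.
by exists j => //; exists B => //; rewrite setTI.
Qed.

Lemma measurable_cyl s v : measurable (cyl s v).
Proof.
elim: s => [|j s IHs]; first by rewrite cyl_nil.
rewrite cyl_cons; apply: measurableI => //.
rewrite (_ : cyl _ _ = [set x | [set v j] (c x j)]); first exact: measurable_coord.
by apply/seteqP; split=> x /= => [|xj i]; [apply; rewrite inE|rewrite inE => /eqP ->].
Qed.

Lemma coord_preimageE (Z : Type) (f : Z -> A) (B : set A) :
  f @^-1` B = \bigcup_(a in B) (f @^-1` [set a]).
Proof.
apply/seteqP; split=> [z Bz|z [a Ba /= fz]]; first by exists (f z).
by rewrite /= fz.
Qed.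

Lemma measurable_to_coord dZ (Z : measurableType dZ) (f : Z -> X) :
  (forall j a, measurable [set z | c (f z) j = a]) -> measurable_fun setT f.
Proof.
move=> mf; apply: measurability (measurable_coordE c) _.
move=> _ [_ [j _ [B mB <-]] <-]; rewrite !setTI.
rewrite -[X in measurable X]/((fun z => c (f z) j) @^-1` B) coord_preimageE.
apply: fin_bigcup_measurable; first exact: finite_finset.
by move=> a _; exact: mf.
Qed.

Lemma measurable_cylE : @measurable dX X = <<s cyl_sets >>.
Proof.
rewrite (measurable_coordE c); apply/seteqP; split; apply: smallest_sub => //.
- move=> _ [j _ [B mB <-]]; rewrite setTI coord_preimageE.
  have -> : \bigcup_(a in B) ((fun x => c x j) @^-1` [set a]) =
      \bigcup_(a in B) cyl [:: j] (fun=> a).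
    apply: eq_bigcupr => a _; apply/seteqP; split=> x /= => [xj i|].
      by rewrite inE => /eqP ->.
    by apply; rewrite inE.
  apply: (@fin_bigcup_measurable _ (g_sigma_algebraType cyl_sets)); first exact: finite_finset.
  by move=> a _; apply: sub_gen_smallest; right; exists [:: j], (fun=> a).
- move=> D [->|[s [v ->]]].
    by have [] := smallest_sigma_algebra setT (\bigcup_(j in [set: J])
      preimage_set_system setT (fun x => c x j) measurable).
  by rewrite -(measurable_coordE c); exact: measurable_cyl.
Qed.

Lemma cyl_setsI : setI_closed cyl_sets.
Proof.
move=> D E [->|[s [v ->]]]; first by left; rewrite set0I.
move=> [->|[t [u ->]]]; first by left; rewrite setI0.
have [->|/set0P[x [xs xt]]] := eqVneq (cyl s v `&` cyl t u) set0; first by left.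
right; exists (s ++ t), (c x); rewrite cyl_cat; congr (_ `&` _).
  by apply: eq_cyl => // j js; rewrite (xs _ js).
by apply: eq_cyl => // j js; rewrite (xt _ js).
Qed.

Lemma cyl_setsT : cyl_sets setT.
Proof.
have [x|noX] := pselect (exists x : X, True).
  case: x => x _; right; exists [::], (c x); by rewrite cyl_nil.
by left; apply/seteqP; split=> // x _; apply: noX; exists x.
Qed.

Lemma measurable_upd s q : measurable_fun setT (upd s q).
Proof.
apply: measurable_to_coord => j a.
have [js|js] := boolP (j \in s).
  have -> : [set z | c (upd s q z) j = a] = [set z | q j = a].
    by apply/seteqP; split=> z /=; rewrite coord_upd js.
  have [qa|qa] := pselect (q j = a).
    by rewrite (_ : [set _ | _] = setT)//; apply/seteqP; split.
  by rewrite (_ : [set _ | _] = set0)//; apply/seteqP; split.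
rewrite (_ : [set _ | _] = [set z | [set a] (c z j)]); first exact: measurable_coord.
by apply/seteqP; split=> z /=; rewrite coord_upd (negbTE js).
Qed.

Lemma upd_id s q x : cyl s q x -> upd s q x = x.
Proof. by move=> xs; apply: coord_inj => j; rewrite coord_upd; case: ifPn => // js; rewrite (xs j js). Qed.

Lemma upd_upd s p q x : upd s p (upd s q x) = upd s p x.
Proof. by apply: coord_inj => j; rewrite !coord_upd; case: ifP => // ->. Qed.

(** The cylinder asks for v on t.  On the sites of s this has become a condition
on q alone, and elsewhere it is unchanged. *)
Lemma upd_preimage_cyl s q t v :
  upd s q @^-1` cyl t v = set0 \/
  upd s q @^-1` cyl t v = cyl [seq j <- t | j \notin s] v.
Proof.
have [all_|nall] := pselect (forall j, j \in t -> j \in s -> q j = v j); last first.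
  left; apply/seteqP; split=> // x /= xt; apply: nall => j jt js.
  by rewrite -(xt j jt) coord_upd js.
right; apply/seteqP; split=> x /= xt j.
  by rewrite mem_filter => /andP[js jt]; rewrite -(xt j jt) coord_upd (negbTE js).
move=> jt; rewrite coord_upd; case: ifPn => js; first exact: all_.
by apply: xt; rewrite mem_filter js.
Qed.

Context (R : realType) (m : J -> probability A R).

Definition weight s v : R := \prod_(j <- s) fine (m j [set v j]).

Definition product_law (mu : probability X R) : Prop :=
  forall s v, uniq s -> fine (mu (cyl s v)) = weight s v.

Lemma weight_ge0 s v : 0 <= weight s v.
Proof. by apply: prodr_ge0 => j _; exact: fine_ge0. Qed.

Lemma cyl_undup s v : cyl (undup s) v = cyl s v.
Proof. by apply: eq_cyl => // j; rewrite mem_undup. Qed.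

(** After q has been written on s, membership in D does not depend on the letters
on s any more, hence it is independent of the event that they spell p. *)
Lemma product_law_upd (mu : probability X R) s p q D : product_law mu ->
  uniq s -> measurable D ->
  fine (mu (cyl s p `&` upd s q @^-1` D)) = weight s p * fine (mu (upd s q @^-1` D)).
Proof.
move=> muP us mD.
rewrite -[X in _ = _ * fine (mu X)]setTI.
apply: (scaled_measure_unique measurable_cylE cyl_setsI cyl_setsT) => //.
- exact: measurable_upd.
- exact: measurable_upd.
- exact: measurable_cyl.
- exact: weight_ge0.
move=> _ [->|[t [v ->]]].
  by rewrite !preimage_set0 !setI0 measure0 mulr0.
rewrite setTI.
have [->|->] := upd_preimage_cyl s q t v; first by rewrite setI0 measure0 mulr0.
pose t' := undup [seq j <- t | j \notin s].
have tE j : j \in t' -> j \notin s.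
  by rewrite mem_undup mem_filter => /andP[].
have ut' : uniq t' by exact: undup_uniq.
rewrite -(cyl_undup [seq j <- t | _]) -/t' [in RHS]muP//.
(* Merge the words on the disjoint sites s and t' into one. *)
pose u j := if j \in s then p j else v j.
have -> : cyl s p = cyl s u by apply: eq_cyl => // j js; rewrite /u js.
have -> : cyl t' v = cyl t' u.
  by apply: eq_cyl => // j /tE /negbTE js; rewrite /u js.
rewrite -cyl_cat muP; last first.
  by rewrite cat_uniq us ut' andbT; apply/hasPn => j /tE.
rewrite /weight big_cat/=; congr (_ * _); apply: eq_big_seq => j.
  by rewrite /u => ->.
by move=> /tE /negbTE js; rewrite /u js.
Qed.

End cylinders.

(** * Generalised Bernoulli shifts: replacing words in invariant sets *)

(** The action moves the letter at site j to site sh n j.  Freeness of the action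
on sites is what makes finite sets of sites leave every finite window. *)
Record bernoulli_shift (R : realType) d (A : finMeasurableType d) dX
    (X : measurableType dX) (J : countType) (c : coordinates A X J)
    (m : J -> probability A R) (mu : probability X R)
    (sh : int -> J -> J) (Q : int -> X -> X) : Prop := {
  bs_law : product_law c m mu;
  bs_index : is_Zaction sh;
  bs_free : forall n j, sh n j = j -> n = 0;
  bs_coord : forall n x j, c (Q n x) j = c x (sh (- n) j);
  bs_nonsingular : forall n B, measurable B ->
    mu B = 0%E -> mu (Q n @^-1` B) = 0%E;
  bs_support : forall j a, 0 < fine (m j [set a]) }.

Section bernoulli.
Context (R : realType) d (A : finMeasurableType d)
  (mA : forall B : set A, measurable B) dX (X : measurableType dX)
  (J : countType) (c : coordinates A X J) (m : J -> probability A R)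
  (mu : probability X R) (sh : int -> J -> J) (Q : int -> X -> X)
  (BS : bernoulli_shift c m mu sh Q).
Implicit Types (s t : seq J) (p q v : J -> A).

Lemma shD n k j : sh n (sh k j) = sh (n + k) j.
Proof. by have [_ ->] := bs_index BS. Qed.

Lemma sh0 j : sh 0 j = j.
Proof. by have [-> _] := bs_index BS. Qed.

Lemma shK k : cancel (sh k) (sh (- k)).
Proof. by move=> j; rewrite shD addNr sh0. Qed.

Lemma mem_sh k j s : (sh k j \in map (sh k) s) = (j \in s).
Proof. by rewrite mem_map//; exact: can_inj (shK k). Qed.

Lemma shift_Zaction : is_Zaction Q.
Proof.
split=> [|n k]; apply/funext => x; apply: (@coord_inj _ _ _ _ _ c) => j.
  by rewrite (bs_coord BS) oppr0 sh0.
by rewrite /= !(bs_coord BS) shD opprD addrC.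
Qed.

Lemma measurable_shift n : measurable_fun setT (Q n).
Proof.
apply: (measurable_to_coord (c := c)) => j a.
rewrite (_ : [set _ | _] = [set x | [set a] (c x (sh (- n) j))]).
  exact: measurable_coord.
by apply/seteqP; split=> x /=; rewrite (bs_coord BS).
Qed.

Lemma weight_gt0 s v : 0 < weight m s v.
Proof. by apply: prodr_gt0 => j _; exact: bs_support BS _ _. Qed.

Context dW (W : measurableType dW) (P : probability W R) (S : int -> W -> W).
Hypotheses (ZS : is_Zaction S) (mS : forall n, measurable_fun setT (S n))
  (PS : measure_preserving P S).

Let N : probability (X * W)%type R := (mu \x P)%E.
Let U := prod_action Q S.

Let NX B V : measurable B -> measurable V -> N (B `*` V) = (mu B * P V)%E.
Proof. by move=> mB mV; exact: product_measure1E. Qed.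

Lemma product_Zaction : is_Zaction U.
Proof.
have [Q0 QD] := shift_Zaction; have [S0 SD] := ZS.
by split=> [|n k]; apply/funext => -[x w]; rewrite /U /prod_action /= ?Q0 ?S0 ?QD ?SD.
Qed.

Lemma measurable_product n : measurable_fun setT (U n).
Proof. by apply: measurable_pair_map => //; exact: measurable_shift. Qed.

Lemma nonsingular_shift_product n D : measurable D -> N D = 0%E -> N (U n @^-1` D) = 0%E.
Proof.
move=> mD; apply: nonsingular_product => //; first exact: measurable_shift.
  by move=> B mB; exact: PS.
exact: bs_nonsingular BS n.
Qed.

Definition cylW s v : set (X * W) := [set z | cyl c s v z.1].
Definition updW s q (z : X * W) := (upd c s q z.1, z.2).

Lemma measurable_cylW s v : measurable (cylW s v).
Proof.
rewrite (_ : cylW s v = cyl c s v `*` setT).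
  by apply: measurableX => //; exact: measurable_cyl.
by apply/seteqP; split=> z //= [].
Qed.

Lemma measurable_updW s q : measurable_fun setT (updW s q).
Proof.
apply: measurable_fun_pair => //.
by apply: measurableT_comp => //; exact: measurable_upd.
Qed.

Lemma product_law_updW s p q D : uniq s -> measurable D ->
  fine (N (cylW s p `&` updW s q @^-1` D)) =
  weight m s p * fine (N (updW s q @^-1` D)).
Proof.
move=> us mD.
rewrite -[X in _ = _ * fine (N X)]setTI.
apply: (scaled_measure_unique (measurable_prod_measurableType X W)) => //.
- move=> _ _ [A1 mA1 [B1 mB1 <-]] [A2 mA2 [B2 mB2 <-]].
  exists (A1 `&` A2); first exact: measurableI.
  by exists (B1 `&` B2); [exact: measurableI|rewrite setXI].
- by exists setT => //; exists setT => //; rewrite setXTT.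
- exact: measurable_updW.
- exact: measurable_updW.
- exact: measurable_cylW.
- exact: weight_ge0.
move=> _ [B mB [V mV <-]].
have mUB : measurable (upd c s q @^-1` B).
  by apply: measurable_preimage => //; exact: measurable_upd.
have -> : cylW s p `&` updW s q @^-1` (B `*` V) =
    (cyl c s p `&` upd c s q @^-1` B) `*` V.
  by apply/seteqP; split=> z /=; rewrite /cylW /=; tauto.
have -> : setT `&` updW s q @^-1` (B `*` V) = (upd c s q @^-1` B) `*` V.
  by apply/seteqP; split=> z /=; tauto.
rewrite !NX//; last by apply: measurableI => //; exact: measurable_cyl.
rewrite !fineM ?fin_num_measure//; last by apply: measurableI => //; exact: measurable_cyl.
by rewrite mulrA; congr (_ * _); exact: product_law_upd (bs_law BS) _ _.
Qed.

(** Writing q over p maps [cylW s p `&` D] onto [cylW s q `&` updW s p @^-1` D].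
The letters outside s are kept, so N is multiplied by the ratio of the weights. *)
Lemma weight_swap s p q D : uniq s -> measurable D ->
  weight m s p * fine (N (cylW s q `&` updW s p @^-1` D)) =
  weight m s q * fine (N (cylW s p `&` D)).
Proof.
move=> us mD.
have -> : cylW s p `&` D = cylW s p `&` updW s p @^-1` D.
  by apply/seteqP; split=> -[x w] /=; rewrite /updW /cylW/= => -[xp]; rewrite upd_id.
by rewrite !product_law_updW// mulrCA.
Qed.

(** The word carried by the sites [map (sh k) s] after the word v on s has been
moved k steps. *)
Definition shift_word (k : int) v : J -> A := fun j => v (sh (- k) j).

(** Exchanging words and then moving k steps is the same as moving and then
exchanging the moved words at the moved sites. *)
Lemma shift_swap k s p q D :
  U (- k) @^-1` (cylW s q `&` updW s p @^-1` D) =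
  cylW (map (sh k) s) (shift_word k q) `&`
    updW (map (sh k) s) (shift_word k p) @^-1` (U (- k) @^-1` D).
Proof.
have cE x : cyl c s q (Q (- k) x) <-> cyl c (map (sh k) s) (shift_word k q) x.
  split=> xs j.
    move=> /mapP[i si ->]; rewrite /shift_word shK -(xs i si).
    by rewrite (bs_coord BS) opprK.
  by move=> js; rewrite (bs_coord BS) opprK xs ?mem_sh// /shift_word shK.
have uE x : upd c s p (Q (- k) x) = Q (- k) (upd c (map (sh k) s) (shift_word k p) x).
  apply: (@coord_inj _ _ _ _ _ c) => j; rewrite !coord_upd !(bs_coord BS) opprK.
  by rewrite coord_upd mem_sh /shift_word shK.
apply/seteqP; split=> -[x w]; rewrite /cylW /updW /U /prod_action /= uE => -[];
  by move=> /cE xs xD; split.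
Qed.

Definition local t (F : set (X * W)) : Prop :=
  forall x x' w, (forall j, j \in t -> c x j = c x' j) -> F (x, w) -> F (x', w).

Lemma local_upd s q t F : local t F -> (forall j, j \in t -> j \notin s) ->
  updW s q @^-1` F = F.
Proof.
move=> lF ts; apply/seteqP; split=> -[x w]; rewrite /updW /=.
  by apply: lF => j /ts js; rewrite coord_upd (negbTE js).
by apply: lF => j /ts js; rewrite coord_upd (negbTE js).
Qed.

Lemma local_approximable D : measurable D ->
  approximable N [set F | exists t, local t F] D.
Proof.
have lU t F t' F' : local t F -> local t' F' -> local (t ++ t') (F `|` F').
  move=> lF lF' x x' w xx' [Fx|Fx]; [left; apply: lF Fx|right; apply: lF' Fx];
    by move=> j jt; apply: xx'; rewrite mem_cat jt ?orbT.
have lC t F : local t F -> local t (~` F).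
  by move=> lF x x' w xx' nF F'; apply: nF; apply: lF F' => j /xx'.
apply: (approximable_all (G := [set B `*` V | B in measurable & V in measurable])) => //.
- by exists [::].
- by move=> F [t lF]; exists t; exact: lC.
- by move=> F F' [t lF] [t' lF']; exists (t ++ t'); exact: lU.
- exact: measurable_prod_measurableType.
move=> _ [B mB [V mV <-]]; split; first exact: measurableX.
pose L : set (set X) := [set F | exists t, forall x x',
  (forall j, j \in t -> c x j = c x' j) -> F x -> F x'].
have [_ aB] : approximable mu L B.
  apply: (approximable_all (G := cyl_sets c)) => //.
  - by exists [::].
  - move=> F [t lF]; exists t => x x' xx' nF F'; apply: nF.
    by apply: lF F' => j /xx'.
  - move=> F F' [t lF] [t' lF']; exists (t ++ t') => x x' xx'.
    move=> [Fx|Fx]; [left; apply: lF Fx|right; apply: lF' Fx];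
    by move=> j jt; apply: xx'; rewrite mem_cat jt ?orbT.
  - exact: measurable_cylE.
  - move=> F CF; split; first by rewrite (measurable_cylE mA c); exact: sub_gen_smallest.
    move=> e e0; exists F; split=> //.
    + case: CF => [->|[t [v ->]]]; first by exists [::].
      by exists t => x x' xx' xt j jt; rewrite -xx'// xt.
    + by rewrite (measurable_cylE mA c); exact: sub_gen_smallest.
    + by rewrite /setY setDv setU0 measure0.
move=> e /aB[F [[t lF] mF Fe]]; exists (F `*` V); split; [|exact: measurableX|].
  by exists t => x x' w xx' [/= Fx Vw]; split => //=; exact: lF Fx.
apply: le_lt_trans Fe.
have mFB : measurable (F `+` B) by apply: measurableU; exact: measurableD.
have -> : fine (mu (F `+` B)) = fine (N ((F `+` B) `*` setT)).
  by rewrite NX// probability_setT mule1.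
apply: le_fine_prob; [|exact: measurableX|by move=> z /=; tauto].
by apply: measurableU; apply: measurableD; exact: measurableX.
Qed.

(** By freeness, a given pair of sites is matched by at most one time k. *)
Lemma eventually_disjoint s t : exists k0 : nat, forall k : nat, (k0 <= k)%N ->
  forall j, j \in t -> j \notin map (sh k%:Z) s.
Proof.
have ev i j : exists k0 : nat, forall k : nat, (k0 <= k)%N -> sh k%:Z i != j.
  have [[k1 k1j]|none] := pselect (exists k : nat, sh k%:Z i = j); last first.
    by exists 0%N => k _; apply/eqP => kj; apply: none; exists k.
  exists k1.+1 => k k1k; apply/eqP; rewrite -k1j => /(congr1 (sh (- k1%:Z))).
  rewrite !shD addNr sh0 => /(bs_free BS) /eqP.
  by rewrite addrC subr_eq0 eqz_nat => /eqP kk1; rewrite kk1 ltnn in k1k.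
have [f fP] := choice (fun ij : J * J => ev ij.1 ij.2).
exists (\max_(i <- s) \max_(j <- t) f (i, j))%N => k kmax j jt.
apply/mapP => -[i si] /esym/eqP; apply/negP.
have := fP (i, j); apply; apply: leq_trans kmax.
apply: (leq_trans _ (@leq_bigmax_seq _ s xpredT
  (fun i => \max_(j <- t) f (i, j))%N i si isT)).
exact: (@leq_bigmax_seq _ t xpredT (fun j => f (i, j)) j jt isT).
Qed.

(** Only times k >= k0 are considered: the marginals are controlled at positive
sites, and the finitely many earlier times do not affect divergent sums. *)
Definition comparable_words s p q : Prop := exists (K : R) (k0 : nat), 0 < K /\
  forall k : nat, (k0 <= k)%N ->
    weight m (map (sh k%:Z) s) (shift_word k q) <=
      K * weight m (map (sh k%:Z) s) (shift_word k p) /\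
    weight m (map (sh k%:Z) s) (shift_word k p) <=
      K * weight m (map (sh k%:Z) s) (shift_word k q).

Hypothesis dQ : divergent_orbits mu Q.

Lemma iter_product k : iter k (U (- 1)) = U (- k%:Z).
Proof.
have [U0 UD] := product_Zaction.
elim: k => [|k IHk]; first by rewrite oppr0 U0.
apply/funext => z; rewrite iterS IHk -[LHS]/((U (- 1) \o U (- k%:Z)) z) -UD.
by rewrite -opprD -PoszD.
Qed.

Let pr (D : set (X * W)) : R := fine (N D).

(** Once the moved sites avoid the window t of F, intersecting with F commutes with
the exchange, and the measures differ by the ratio of the moved weights. *)
Lemma swap_local k s p q t F C : uniq s -> measurable F -> measurable C ->
  C `<=` cylW s p -> local t F ->
  (forall j, j \in t -> j \notin map (sh k) s) ->
  weight m (map (sh k) s) (shift_word k p) *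
    pr (U (- k) @^-1` (cylW s q `&` updW s p @^-1` C) `&` F) =
  weight m (map (sh k) s) (shift_word k q) * pr (U (- k) @^-1` C `&` F).
Proof.
move=> us mF mC Cp lF ts; rewrite shift_swap.
have mUC : measurable (U (- k) @^-1` C).
  by apply: measurable_preimage => //; exact: measurable_product.
rewrite -setIA -[X in _ `&` (_ `&` X)](local_upd (s := map (sh k) s) (shift_word k p) lF ts).
rewrite -preimage_setI.
have us' : uniq (map (sh k) s) by rewrite map_inj_uniq//; exact: can_inj (shK k).
apply: (etrans (weight_swap (shift_word k p) (shift_word k q) us' (measurableI _ _ mUC mF))).
rewrite setIA (@setIidr _ _ (U (- k) @^-1` C))//.
move=> [x w] /Cp Cx j /mapP[i si ->]; have /= := Cx i si.
by rewrite (bs_coord BS) opprK /shift_word shK.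
Qed.

(** The Hopf argument.  If the set C0 of points outside B that enter B when q is
written over p had positive measure a, then B could be approximated by a local F
with error e * e.  Remove from C0 the points for which they or their modification
lie in the exceptional set E of the maximal inequality; this leaves a set C of
positive measure, with modification C' inside B.  Along the orbit the images of
C' are in B and those of C are not, while their intersections with F have
comparable measures.  Since F and B differ along these orbits only with
frequency e, the divergent sum of N (U_k C') is bounded. *)
Lemma swap_invariant s p q (B : set (X * W)) : uniq s -> comparable_words s p q ->
  measurable B -> (forall n, U n @^-1` B = B) ->
  pr (cylW s p `&` ~` B `&` updW s q @^-1` B) = 0.
Proof.
move=> us [K [k0 [K0 Kpq]]] mB UB.
pose C0 := cylW s p `&` ~` B `&` updW s q @^-1` B.
have mCp := measurable_cylW s p.
have mup v D : measurable D -> measurable (updW s v @^-1` D).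
  by move=> mD; apply: measurable_preimage => //; exact: measurable_updW.
have mU k D : measurable D -> measurable (U k @^-1` D).
  by move=> mD; apply: measurable_preimage => //; exact: measurable_product.
have mC0 : measurable C0.
  by apply: measurableI; [apply: measurableI => //; exact: measurableC|exact: mup].
rewrite -/C0; apply/eqP; rewrite eq_le fine_prob_ge0 andbT leNgt; apply/negP => a0.
set a := pr C0 in a0.
pose wp := weight m s p; pose wq := weight m s q.
have wp0 : 0 < wp := weight_gt0 s p.
have wq0 : 0 < wq := weight_gt0 s q.
pose r := wp / wq; have r0 : 0 < r by rewrite divr_gt0.
(* The first bound on e keeps C nonnull, the second one closes the final
   estimate, in which the sum over U_k C' is bounded by
   e (1 + K * K) times itself plus a constant. *)
pose e := Num.min (a / (2 * (1 + r))) (2 * (1 + K * K))^-1.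
have e0 : 0 < e.
  rewrite lt_min divr_gt0 ?mulr_gt0 ?addr_gt0//= invr_gt0.
  by rewrite mulr_gt0 ?addr_gt0 ?mulr_gt0.
have [_ /(_ (e * e) (mulr_gt0 e0 e0))[F [[t lF] mF Fe]]] :=
  local_approximable mB.
pose H := F `+` B.
have mH : measurable H by apply: measurableU; exact: measurableD.
have UK : cancel (U (- 1)) (U 1).
  have [U0 UD] := product_Zaction.
  by move=> z; rewrite -[LHS]/((U 1 \o U (- 1)) z) -UD subrr U0.
have nsU D : measurable D -> N D = 0%E -> N (U (- 1) @^-1` D) = 0%E.
  exact: nonsingular_shift_product.
have [E [mE NE maxE]] := ratio_maximal_inequality (measurable_product 1)
  (measurable_product (- 1)) UK nsU mH e0.
have Ee : pr E <= e.
  by rewrite -(ler_pM2l e0); apply: le_trans NE _; exact: ltW.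
pose C := C0 `&` (~` E `&` ~` (updW s q @^-1` E)).
have mC : measurable C.
  apply: measurableI => //; apply: measurableI; apply: measurableC; [exact: mE|exact: mup mE].
have Cp : C `<=` cylW s p by move=> z [[[]]].
have CB : C `<=` ~` B by move=> z [[[]]].
have CE : C `<=` ~` E by move=> z [_ []].
(* Writing q over p multiplies measures by r ^-1, so that the two removed parts
   have measure at most e and r * e. *)
have C_gt0 : 0 < pr C.
  have mpE : measurable (cylW s p `&` updW s q @^-1` E).
    by apply: measurableI => //; exact: mup.
  have sub : C0 `<=` C `|` (E `|` (cylW s p `&` updW s q @^-1` E)).
    move=> z C0z; have [Ez|nEz] := pselect (E z); first by right; left.
    have [uE|nuE] := pselect (E (updW s q z)); last by left.
    by right; right; split=> //; case: C0z => [[]].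
  have : a <= pr C + (e + r * e).
    apply: le_trans (le_fine_prob N mC0 _ sub) _.
      by apply: measurableU => //; exact: measurableU.
    apply: le_trans (fine_probU_le N mC _) _; first exact: measurableU.
    rewrite lerD2l; apply: le_trans (fine_probU_le N mE mpE) _; rewrite lerD//.
    have wE := weight_swap q p us mE.
    have -> : fine (N (cylW s p `&` updW s q @^-1` E)) = r * pr (cylW s q `&` E).
      by rewrite /r mulrAC -wE mulrAC mulfV ?mul1r// gt_eqF.
    rewrite ler_pM2l//; apply: le_trans Ee; apply: le_fine_prob => //.
    by apply: measurableI => //; exact: measurable_cylW.
  have : e + r * e <= a / 2.
    have : e * (2 * (1 + r)) <= a.
      by rewrite -ler_pdivlMr ?mulr_gt0 ?addr_gt0// /e ge_min lexx.
    have -> : e + r * e = e * (2 * (1 + r)) / 2 by field.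
    lra.
  lra.
pose C' := cylW s q `&` updW s p @^-1` C.
have mC' : measurable C' by apply: measurableI; [exact: measurable_cylW|exact: mup].
have C'up z : C' z -> B z /\ ~ E z.
  case: z => x w [/= xq [[_ /= uB] [_ /= nuE]]].
  by move: uB nuE; rewrite /updW /= upd_upd upd_id.
have C'_gt0 : 0 < pr C'.
  have := weight_swap p q us mC; rewrite (setIidr Cp) => wE.
  by rewrite -(pmulr_rgt0 _ wp0) wE pmulr_rgt0.
have UNB k z : B (U (- k) z) <-> B z by rewrite -[X in _ <-> X]/(B z) -{2}(UB (- k)).
have [k1 k1P] := eventually_disjoint s t.
pose k2 := maxn k0 k1.
(* The two comparisons that hold at all late times. *)
have ineq k : (k2 <= k)%N ->
   pr (U (- k%:Z) @^-1` C' `&` F) <= K * pr (U (- k%:Z) @^-1` C `&` F) /\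
   pr (U (- k%:Z) @^-1` C) <= K * pr (U (- k%:Z) @^-1` C').
  rewrite geq_max => /andP[/Kpq[Kq Kp] /k1P dis].
  have g0 v : 0 < weight m (map (sh k%:Z) s) (shift_word k v) := weight_gt0 _ _.
  split.
    rewrite -(ler_pM2l (g0 p)) (swap_local q us mF mC Cp lF dis).
    by rewrite mulrCA mulrA ler_wpM2r ?fine_prob_ge0.
  have lT : local [::] [set: X * W] by [].
  have := @swap_local k%:Z s p q [::] setT C us measurableT mC Cp lT.
  move=> /(_ (fun j (h : j \in [::]) => False_ind _ (notF h))).
  rewrite !setIT => wE.
  by rewrite -(ler_pM2l (g0 q)) -wE mulrCA mulrA ler_wpM2r ?fine_prob_ge0.
have C'E : C' `<=` ~` E by move=> z /C'up[].
have [n nM] := product_divergent measurable_shift mS PS dQ mC' C'_gt0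
  (k2%:R + k2%:R + 2 * (e * k2%:R * (1 + K))).
have := maxE C' (k2 + n)%N mC' C'E; have := maxE C (k2 + n)%N mC CE.
have le1 D : measurable D -> pr D <= 1 by exact: fine_prob_le1.
have lesum (f : nat -> R) : (forall k, f k <= 1) -> \sum_(k < k2) f k <= k2%:R.
  move=> f1; rewrite (_ : k2%:R = \sum_(k < k2) (1 : R)); last first.
    by rewrite sumr_const card_ord.
  by apply: ler_sum => k _; exact: f1.
(* From here on: sums of numbers.  The first k2 terms of each sum contribute at
   most k2, and sg f is the sum of the n following terms of f. *)
pose x k := pr (U (- k%:Z) @^-1` C); pose x' k := pr (U (- k%:Z) @^-1` C').
pose y k := pr (U (- k%:Z) @^-1` C `&` H); pose y' k := pr (U (- k%:Z) @^-1` C' `&` H).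
have x0 k : 0 <= x' k by exact: fine_prob_ge0.
have y0 k : 0 <= y k by exact: fine_prob_ge0.
have y'0 k : 0 <= y' k by exact: fine_prob_ge0.
pose sg f := \sum_(i < n) f (k2 + i)%N : R.
have fold (f : nat -> R) (g : nat -> set (X * W)) :
   (forall k, pr (g k) = f k) -> \sum_(k < k2 + n) fine (N (g k)) = \sum_(k < k2) f k + sg f.
  by move=> fg; rewrite big_split_ord /=; congr (_ + _); apply: eq_bigr => i _; exact: fg.
pose it k (D : set (X * W)) := iter k (U (- 1)) @^-1` D.
have itE k D : it k D = U (- k%:Z) @^-1` D by rewrite /it iter_product.
rewrite (fold x (it^~ C)) ?(fold y (fun k => it k C `&` H)); try by move=> k; rewrite itE.
rewrite (fold x' (it^~ C')) ?(fold y' (fun k => it k C' `&` H)); try by move=> k; rewrite itE.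
have lx : \sum_(k < k2) x k <= k2%:R by apply: lesum => k; apply: le1; exact: mU.
have lx' : \sum_(k < k2) x' k <= k2%:R by apply: lesum => k; apply: le1; exact: mU.
have ly : 0 <= \sum_(k < k2) y k by apply: sumr_ge0.
have ly' : 0 <= \sum_(k < k2) y' k by apply: sumr_ge0.
(* Split U_k C' by F.  The part in F is at most K times the part of U_k C in F,
   which lies in H because U_k C avoids B; the part outside F lies in H because
   U_k C' is contained in B. *)
have main : sg x' <= K * sg y + sg y'.
  rewrite /sg mulr_sumr -big_split /=; apply: ler_sum => i _.
  set k := (k2 + i)%N; have [h _] := ineq k (leq_addr _ _).
  have mUC' := mU (- k%:Z) _ mC'; have mUC := mU (- k%:Z) _ mC.
  rewrite /x' (_ : pr _ = pr (U (- k%:Z) @^-1` C' `&` F) + pr (U (- k%:Z) @^-1` C' `&` ~` F)).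
    apply: lerD.
      apply: le_trans h _; rewrite ler_pM2l//; apply: le_fine_prob; try exact: measurableI.
      move=> z [Cz Fz]; split=> //; left; split=> //.
      by have := CB _ Cz; rewrite /= UNB.
    apply: le_fine_prob; [apply: measurableI => //; exact: measurableC|exact: measurableI|].
    move=> z [Cz nFz]; split=> //; right; split=> //.
    by have [] := C'up _ Cz; rewrite UNB.
  exact: fine_prob_split.
have sgx : sg x <= K * sg x'.
  rewrite /sg mulr_sumr; apply: ler_sum => i _.
  by have [_] := ineq (k2 + i)%N (leq_addr _ _).
have big : k2%:R + 2 * (e * k2%:R * (1 + K)) < sg x'.
  have : \sum_(k < n) fine (N (U (- k%:Z) @^-1` C')) <= \sum_(k < k2) x' k + sg x'.
    rewrite -(fold x' (fun k => U (- k%:Z) @^-1` C'))// addnC big_split_ord /= lerDl.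
    by apply: sumr_ge0 => i _; exact: fine_prob_ge0.
  by move=> h; lra.
have eK : e * (1 + K * K) <= 1 / 2.
  have KK : 0 < 1 + K * K by rewrite addr_gt0 ?mulr_gt0.
  rewrite -ler_pdivlMr// div1r -invfM; by rewrite /e ge_min lexx orbT.
move=> m1 m2.
have z0 : 0 <= sg x' by apply: sumr_ge0.
have k20 : 0 <= (k2%:R : R) by [].
have s1 : sg y <= e * (k2%:R + K * sg x').
  apply: le_trans (_ : e * (\sum_(k < k2) x k + sg x) <= _); first by lra.
  by rewrite ler_pM2l// lerD.
have s2 : sg y' <= e * (k2%:R + sg x').
  apply: le_trans (_ : e * (\sum_(k < k2) x' k + sg x') <= _); first by lra.
  by rewrite ler_pM2l// lerD.
have s3 : K * sg y <= K * (e * (k2%:R + K * sg x')) by rewrite ler_pM2l.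
have s4 : (e * (1 + K * K)) * sg x' <= 1 / 2 * sg x' by rewrite ler_wpM2r.
nra.
Qed.

End bernoulli.

(** * Sets independent of every coordinate *)

Section zero_one.
Context (R : realType) d (A : finMeasurableType d)
  (mA : forall B : set A, measurable B) dX (X : measurableType dX)
  (J : countType) (c : coordinates A X J) (m : J -> probability A R)
  (mu : probability X R) (sh : int -> J -> J) (Q : int -> X -> X)
  (BS : bernoulli_shift c m mu sh Q).
Context dW (W : measurableType dW) (P : probability W R) (S : int -> W -> W).
Hypotheses (ZS : is_Zaction S) (mS : forall n, measurable_fun setT (S n)).
Implicit Types (s t : seq J) (v : J -> A).

Let N : probability (X * W)%type R := (mu \x P)%E.
Let U := prod_action Q S.

(** Local events are the ones for which the exchange of letters at distant sites
is available; by [letter_independent_rect] they determine the independence. *)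
Definition letter_independent (B : set (X * W)) : Prop :=
  forall j t (F : set (X * W)) a, measurable F -> local c t F -> j \notin t ->
    fine (N (B `&` F `&` cylW c [:: j] (fun=> a))) =
    fine (m j [set a]) * fine (N (B `&` F)).

(** The letters are split off one at a time; the event that remains is local on
the other sites. *)
Lemma letter_independent_cyl B s v (V : set W) : measurable B -> measurable V ->
  letter_independent B -> uniq s ->
  fine (N (B `&` (snd @^-1` V) `&` (fst @^-1` cyl c s v))) =
    weight m s v * fine (N (B `&` (snd @^-1` V))).
Proof.
move=> mB mV iB; elim: s => [|j s IHs].
  by rewrite cyl_nil preimage_setT setIT /weight big_nil mul1r.
move=> /= /andP[js us]; rewrite /weight big_cons -mulrA -IHs// -!setIA.
have mF : measurable (snd @^-1` V `&` fst @^-1` cyl c s v : set (X * W)).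
  by apply: measurableI; apply: measurable_preimage => //; exact: measurable_cyl.
rewrite -(iB j s)//; last first.
  move=> x x' w xx' [/= Vw xs]; split=> // i si /=.
  by rewrite -xx'// xs.
rewrite cyl_cons preimage_setI.
have <- : cylW c [:: j] (fun=> v j) = fst @^-1` cyl c [:: j] v :> set (X * W).
  by apply/seteqP; split=> -[x w] /= xj i; rewrite inE => /eqP ->; apply: xj; rewrite inE.
by rewrite /N; congr (fine (_ _)); apply/seteqP; split=> z /=; tauto.
Qed.

Lemma letter_independent_rect B (V : set W) D : measurable B -> measurable V ->
  letter_independent B -> measurable D ->
  fine (N (B `&` (snd @^-1` V) `&` (fst @^-1` D))) =
    fine (N (B `&` (snd @^-1` V))) * fine (mu D).
Proof.
move=> mB mV iB mD; rewrite -[X in fine (mu X)]setTI.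
apply: (scaled_measure_unique (f2 := id) (measurable_cylE mA c)
   (@cyl_setsI _ _ _ _ _ c) (cyl_setsT c)) => //.
- by apply: measurableI => //; exact: measurable_preimage.
- exact: fine_prob_ge0.
move=> _ [->|[s [v ->]]]; first by rewrite !preimage_set0 !setI0 !measure0 mulr0.
rewrite setTI -cyl_undup letter_independent_cyl ?undup_uniq//.
by rewrite mulrC preimage_id (bs_law BS) ?undup_uniq.
Qed.

(** Independence says that N (B & D) is the mass of the triples (x', x, w) with
(x, w) in B and (x', w) in D, where x' is drawn independently of (x, w).  Taking
for D the complement of B, almost no such triple has (x, w) in B and (x', w)
outside B; so for almost every w, the section of B at w or that of its complement
is null. *)
Lemma letter_independent_dichotomy B : measurable B -> letter_independent B ->
  P ([set w | mu (ysection B w) != 0%E] `&` [set w | mu (ysection (~` B) w) != 0%E]) = 0%E.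
Proof.
move=> mB iB.
have mBc := measurableC mB.
(* A triple is ordered as (x', (x, w)). *)
pose f2 (z : X * (X * W)) := (z.1, z.2.2).
have mf2 : measurable_fun setT f2.
  by apply: measurable_fun_pair => //; apply: measurableT_comp.
pose E2 : set (X * (X * W)) := snd @^-1` B.
have mE2 : measurable E2 by exact: measurable_preimage.
pose M : probability (X * (X * W))%type R := (mu \x N)%E.
have eqP D : measurable D ->
   fine (N (B `&` id @^-1` D)) = 1 * fine (M (E2 `&` f2 @^-1` D)).
  apply: (scaled_measure_unique (measurable_prod_measurableType X W)) => //.
  - move=> _ _ [A1 mA1 [B1 mB1 <-]] [A2 mA2 [B2 mB2 <-]].
    exists (A1 `&` A2); first exact: measurableI.
    by exists (B1 `&` B2); [exact: measurableI|rewrite setXI].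
  - by exists setT => //; exists setT => //; rewrite setXTT.
  move=> _ [D1 mD1 [V mV <-]]; rewrite mul1r preimage_id.
  have -> : B `&` D1 `*` V = B `&` (snd @^-1` V) `&` (fst @^-1` D1).
    by apply/seteqP; split=> z /=; tauto.
  have -> : E2 `&` f2 @^-1` (D1 `*` V) = D1 `*` (B `&` (snd @^-1` V)).
    by apply/seteqP; split=> z /=; rewrite /E2 /=; tauto.
  have mBV : measurable (B `&` snd @^-1` V) by apply: measurableI => //; exact: measurable_preimage.
  have -> : M (D1 `*` (B `&` (snd @^-1` V))) = (mu D1 * N (B `&` (snd @^-1` V)))%E.
    exact: product_measure1E.
  by rewrite letter_independent_rect// fineM ?fin_num_measure// mulrC.
have := eqP _ mBc; rewrite preimage_id setICr measure0 mul1r /= => /esym Z0.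
pose Z := E2 `&` f2 @^-1` ~` B.
have mZ : measurable Z by apply: measurableI => //; exact: measurable_preimage.
have /(null_ysection mu N mZ) Zn : M Z = 0%E by apply: (fine_prob_eq0 M mZ).1.
pose V0 := [set w | mu (ysection B w) != 0%E].
pose V1 := [set w | mu (ysection (~` B) w) != 0%E].
have mV0 : measurable V0.
  by rewrite -[V0]setTI; apply: emeasurable_neq => //; exact: measurable_fun_ysection.
have mV1 : measurable V1.
  by rewrite -[V1]setTI; apply: emeasurable_neq => //; exact: measurable_fun_ysection.
have mBV : measurable (B `&` snd @^-1` V1) by apply: measurableI => //; exact: measurable_preimage.
have /(null_ysection mu P mBV) : N (B `&` snd @^-1` V1) = 0%E.
  apply: (subset_measure0 _ _ _ Zn) => //.
    by rewrite -[X in measurable X]setTI; apply: emeasurable_neq => //; exact: measurable_fun_ysection.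
  move=> [x w] [Bz V1w] /=.
  rewrite (_ : ysection Z (x, w) = ysection (~` B) w)//.
  apply/seteqP; split=> x'; rewrite /ysection /= !inE; first by case.
  by move=> nB; split.
apply: subset_measure0 => //; first exact: measurableI.
  by rewrite -[X in measurable X]setTI; apply: emeasurable_neq => //; exact: measurable_fun_ysection.
move=> w [V0w V1w] /=; rewrite (_ : ysection (B `&` snd @^-1` V1) w = ysection B w)//.
by apply/seteqP; split=> x; rewrite /ysection /= !inE; [case|split].
Qed.

(** The sets of w at which the section of B, respectively of its complement, is
null are invariant under S because the shift is nonsingular.  By the dichotomy
they cover almost all of W, so ergodicity makes one of them conull. *)
Lemma letter_independent_trivial B : ergodic P S -> measurable B ->
  (forall n, U n @^-1` B = B) -> letter_independent B ->
  N B = 0%E \/ N (~` B) = 0%E.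
Proof.
move=> eS mB UB iB.
have inv C : measurable C -> (forall n, U n @^-1` C = C) ->
    P [set w | mu (ysection C w) != 0%E] = 0%E \/ P (~` [set w | mu (ysection C w) != 0%E]) = 0%E.
  move=> mC UC; apply: eS.
    by rewrite -[X in measurable X]setTI; apply: emeasurable_neq => //; exact: measurable_fun_ysection.
  have yE n w : ysection C w = Q n @^-1` ysection C (S n w).
    apply/seteqP; split=> x; rewrite /ysection /= !inE;
    by have -> : C (x, w) = C (U n (x, w)) by rewrite -{1}(UC n).
  have ns n w : mu (ysection C (S n w)) = 0%E -> mu (ysection C w) = 0%E.
    by rewrite (yE n w); apply: (bs_nonsingular BS); exact: measurable_ysection.
  move=> n; apply/seteqP; split=> w /=; apply: contra_neq => mu0; last exact: ns mu0.
  apply: (ns (- n)); have [S0 SD] := ZS.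
  by rewrite -[S _ (S n w)]/((S (- n) \o S n) w) -SD addNr S0.
have mBc := measurableC mB.
have UBc n : U n @^-1` (~` B) = ~` B by rewrite -[in RHS](UB n).
case: (inv B mB UB) => [/(null_ysection mu P mB)|PB]; first by left.
case: (inv _ mBc UBc) => [/(null_ysection mu P mBc)|PBc]; first by right.
exfalso; have dich := letter_independent_dichotomy mB iB.
set V0 := [set w | mu (ysection B w) != 0%E] in PB dich.
set V1 := [set w | mu (ysection (~` B) w) != 0%E] in PBc dich.
have mV0 : measurable V0.
  by rewrite -[V0]setTI; apply: emeasurable_neq => //; exact: measurable_fun_ysection.
have mV1 : measurable V1.
  by rewrite -[V1]setTI; apply: emeasurable_neq => //; exact: measurable_fun_ysection.
have : 1 <= fine (P (V0 `&` V1)) + (fine (P (~` V0)) + fine (P (~` V1))).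
  rewrite -(fine_probT P); apply: le_trans (lerD (lexx _) (fine_probU_le P (measurableC mV0) (measurableC mV1))).
  have mI := measurableI _ _ mV0 mV1; have mU := measurableU _ _ (measurableC mV0) (measurableC mV1).
  apply: le_trans (fine_probU_le P mI mU); apply: le_fine_prob => //; first exact: measurableU.
  by move=> w _ /=; have := EM (V0 w); have := EM (V1 w); tauto.
by rewrite dich PB PBc /= !addr0 ler10.
Qed.

End zero_one.

(** * From replacement of words to independence *)

Section letter_independence.
Context (R : realType) d (A : finMeasurableType d)
  (mA : forall B : set A, measurable B) dX (X : measurableType dX)
  (J : countType) (c : coordinates A X J) (m : J -> probability A R)
  (mu : probability X R) (sh : int -> J -> J) (Q : int -> X -> X)
  (BS : bernoulli_shift c m mu sh Q) (dQ : divergent_orbits mu Q).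
Context dW (W : measurableType dW) (P : probability W R) (S : int -> W -> W).
Hypotheses (ZS : is_Zaction S) (mS : forall n, measurable_fun setT (S n))
  (PS : measure_preserving P S).
Implicit Types (s t : seq J) (p q v : J -> A).

Let N : probability (X * W)%type R := (mu \x P)%E.
Let U := prod_action Q S.
Let pr (D : set (X * W)) : R := fine (N D).

Variable B : set (X * W).
Hypotheses (mB : measurable B) (UB : forall n, U n @^-1` B = B).

Let fine_eq (D E : set (X * W)) : measurable D -> measurable E ->
  pr (D `&` ~` E) = 0 -> pr (E `&` ~` D) = 0 -> pr D = pr E.
Proof.
move=> mD mE DE ED; rewrite /pr (fine_prob_split N mD mE) (fine_prob_split N mE mD).
by rewrite -[X in _ + X]/(pr (D `&` ~` E)) DE -[X in _ = _ + X]/(pr (E `&` ~` D)) ED setIC.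
Qed.

(** By [swap_invariant] for B and for its complement, B is unchanged, up to a null
set, when q is written over p; so [weight_swap] applies to B & F. *)
Lemma swap_exchange s p q F : uniq s -> comparable_words m sh s p q ->
  measurable F -> (forall v, updW c s v @^-1` F = F) ->
  weight m s p * pr (B `&` F `&` cylW c s q) =
  weight m s q * pr (B `&` F `&` cylW c s p).
Proof.
move=> us pq mF uF.
have mup v D : measurable D -> measurable (updW c s v @^-1` D).
  by move=> mD; apply: measurable_preimage => //; exact: measurable_updW.
have mCp := measurable_cylW mA c (W := W) s p.
have mBF := measurableI _ _ mB mF.
have mBc := measurableC mB.
have UBc n : U n @^-1` (~` B) = ~` B by rewrite -[in RHS](UB n).
rewrite setIC -(weight_swap mA BS P q p us mBF); congr (_ * _).
rewrite preimage_setI uF; apply: fine_eq.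
- by apply: measurableI => //; apply: measurableI => //; exact: mup.
- by apply: measurableI.
- apply/eqP; rewrite eq_le fine_prob_ge0 andbT.
  rewrite -(swap_invariant mA BS ZS mS PS dQ us pq mB UB); apply: le_fine_prob.
  + apply: measurableI; last by apply: measurableC; exact: measurableI.
    by apply: measurableI => //; apply: measurableI => //; exact: mup.
  + by apply: measurableI; [exact: measurableI|exact: mup].
  + by move=> z /=; tauto.
- apply/eqP; rewrite eq_le fine_prob_ge0 andbT.
  rewrite -(swap_invariant mA BS ZS mS PS dQ us pq mBc UBc); apply: le_fine_prob.
  + apply: measurableI; first exact: measurableI.
    apply: measurableC; apply: measurableI => //; apply: measurableI => //.
    exact: mup.
  + by apply: measurableI; [apply: measurableI => //; exact: measurableC|exact: mup].
  + by move=> z /=; have := EM (B z); tauto.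
Qed.

Lemma sum_letters (D : set (X * W)) j : measurable D ->
  \sum_(b : A) pr (D `&` cylW c [:: j] (fun=> b)) = pr D.
Proof.
move=> mD; have mg b : measurable ((fun z : X * W => c z.1 j) @^-1` [set b]).
  rewrite (_ : _ @^-1` _ = cylW c [:: j] (fun=> b)); first exact: measurable_cylW.
  by apply/seteqP; split=> z /= => [zj i|]; [rewrite inE => /eqP ->|apply; rewrite inE].
rewrite /pr -(sum_fibers N mg mD); apply: eq_bigr => b _.
congr (fine (N (_ `&` _))); apply/seteqP; split=> z /=; first by apply; rewrite inE.
by move=> zj i; rewrite inE => /eqP ->.
Qed.

Lemma sum_alphabet j : \sum_(b : A) fine (m j [set b]) = 1.
Proof.
rewrite -(fine_probT (m j)) -(sum_fibers (g := id) (m j))//.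
by apply: eq_bigr => b _; rewrite setTI.
Qed.

Lemma weight1 j v : weight m [:: j] v = fine (m j [set v j]).
Proof. by rewrite /weight big_seq1. Qed.

Lemma local_free j s t (F : set (X * W)) v : local c t F -> j \notin t -> s = [:: j] ->
  updW c s v @^-1` F = F.
Proof.
move=> lF jt ->; apply: local_upd lF _ => i it; rewrite inE.
by apply: contraNneq jt => <-.
Qed.

(** By the exchange, the measures of B & F on the events that site j carries a
given letter are proportional to the weights of the letters. *)
Lemma single_letter_independent :
  (forall j a b, comparable_words m sh [:: j] (fun=> a) (fun=> b)) ->
  letter_independent c m mu P B.
Proof.
move=> cmp j t F a mF lF jt.
have ex b := swap_exchange (isT : uniq [:: j]) (cmp j a b) mF
  (fun v => local_free v lF jt erefl).
rewrite -[fine _]/(pr _) -[fine (_ (B `&` F))]/(pr (B `&` F)).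
rewrite -(sum_letters j (measurableI _ _ mB mF)) mulr_sumr.
under eq_bigr => b _ do rewrite -(weight1 j (fun=> a)) ex weight1.
by rewrite -mulr_suml sum_alphabet mul1r.
Qed.


Section two_letters.
Variables (a b : A).
Hypotheses (ab : a != b) (alphabet2 : forall u : A, u = a \/ u = b).

Let pa j := fine (m j [set a]).
Let pb j := fine (m j [set b]).

Hypothesis exchangeable : forall i j, i != j -> comparable_words m sh [:: i; j]
  (fun k => if k == i then a else b) (fun k => if k == i then b else a).
Hypothesis diverging : forall t M, exists s,
  [/\ uniq s, (forall j, j \in s -> j \notin t) & M < \sum_(j <- s) pa j * pb j].

Let sum2 (f : A -> R) : \sum_(u : A) f u = f a + f b.
Proof.
rewrite (bigD1 a)//= (bigD1 b) 1?eq_sym//= big1 ?addr0// => u /andP[ua ub].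
by case: (alphabet2 u) ua ub => ->; rewrite eqxx.
Qed.

Let pab j : pa j + pb j = 1.
Proof. by rewrite -(sum_alphabet j) sum2. Qed.

Let pa0 j : 0 < pa j := bs_support BS j a.
Let pb0 j : 0 < pb j := bs_support BS j b.

Let pr_cylW s v : uniq s -> pr (cylW c s v) = weight m s v.
Proof.
move=> us; have := product_law_updW mA BS P v v us (@measurableT _ (X * W)%type).
rewrite preimage_setT setIT => h; apply: (etrans h).
by rewrite -[X in _ * X]/(fine (N setT)) fine_probT mulr1.
Qed.

Section fixed_letter.
Variable j0 : J.

(* The function E n is the centred indicator of the letter a at site n, weighted
   by the density r n which gives site j0 the law of site n.  Under the weighted
   measure the sites j0 and n have the same law, so that the exchange of the two
   sites is a symmetry. *)
Let e n (u : A) : R := (u == a)%:R - pa n.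
Let r n (u : A) : R := fine (m n [set u]) / fine (m j0 [set u]).
Let E n (z : X * W) : R := e n (c z.1 n) * r n (c z.1 j0).

Let word2 (u v : A) : J -> A := fun k => if k == j0 then u else v.

Let fiber2 n (u v : A) : n != j0 ->
  (fun z : X * W => (c z.1 j0, c z.1 n)) @^-1` [set (u, v)] = cylW c [:: j0; n] (word2 u v).
Proof.
move=> nj; apply/seteqP; split=> z /=.
  by move=> [zj zn] i; rewrite !inE /word2; case: eqP => [->|_ /eqP ->].
move=> zc; rewrite (zc j0) ?inE ?eqxx// (zc n) ?inE ?eqxx ?orbT//.
by rewrite /word2 eqxx (negbTE nj).
Qed.

Let weight2 n (u v : A) : n != j0 ->
  weight m [:: j0; n] (word2 u v) = fine (m j0 [set u]) * fine (m n [set v]).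
Proof. by move=> nj; rewrite /weight big_cons big_seq1 /word2 eqxx (negbTE nj). Qed.

Let E2 n D : n != j0 -> measurable D -> forall f : A -> A -> R,
  \int[N]_(z in D) f (c z.1 j0) (c z.1 n) =
  \sum_(u : A) \sum_(v : A) f u v * pr (D `&` cylW c [:: j0; n] (word2 u v)).
Proof.
move=> nj mD f; pose g (z : X * W) := (c z.1 j0, c z.1 n).
have mg tt : measurable (g @^-1` [set tt]).
  by case: tt => u v; rewrite fiber2//; exact: measurable_cylW.
rewrite (Rintegral_factor N mg (fun x => f x.1 x.2) mD).
rewrite pair_bigA /=; apply: eq_bigr => -[u v] _ /=.
by rewrite fiber2.
Qed.

Let simpleE n : simple_variable (E n).
Proof.
exists (A * A)%type, (fun z => (c z.1 j0, c z.1 n)), (fun x => e n x.2 * r n x.1).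
split=> // -[u v]; have [->|nj] := eqVneq n j0; last first.
  by rewrite fiber2//; exact: measurable_cylW.
rewrite (_ : _ @^-1` _ = (cylW c [:: j0] (fun=> u)) `&` (cylW c [:: j0] (fun=> v))).
  by apply: measurableI; exact: measurable_cylW.
apply/seteqP; split=> z /=.
  by move=> [zu zv]; split=> i; rewrite inE => /eqP ->.
by move=> [zu zv]; congr (_, _); [apply: zu|apply: zv]; rewrite inE.
Qed.

Let K := 1 / pa j0 + 1 / pb j0.

(* The density r n has second moment at most K, and is independent of e n. *)
Let normE n : n != j0 -> \int[N]_z (E n z * E n z) <= K * (pa n * pb n).
Proof.
move=> nj; rewrite (E2 nj measurableT (fun u u' => e n u' * r n u * (e n u' * r n u))).
rewrite !sum2 !setTI !pr_cylW//=; try by rewrite inE eq_sym nj.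
rewrite !weight2// /e /r eqxx eq_sym (negbTE ab) -/(pa n) -/(pb n) -/(pa j0) -/(pb j0) /K.
have p0 := pa0 j0; have q0 := pb0 j0; have p1 := pa0 n; have q1 := pb0 n.
have qE : pb n = 1 - pa n by rewrite -(pab n) addrC addKr.
have -> : (1%:R - pa n) * (pa n / pa j0) * ((1%:R - pa n) * (pa n / pa j0)) * (pa j0 * pa n) +
  (0%:R - pa n) * (pa n / pa j0) * ((0%:R - pa n) * (pa n / pa j0)) * (pa j0 * pb n) +
  ((1%:R - pa n) * (pb n / pb j0) * ((1%:R - pa n) * (pb n / pb j0)) * (pb j0 * pa n) +
  (0%:R - pa n) * (pb n / pb j0) * ((0%:R - pa n) * (pb n / pb j0)) * (pb j0 * pb n)) =
  (pa n * pa n / pa j0 + pb n * pb n / pb j0) * (pa n * pb n).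
  by rewrite qE; field; rewrite !gt_eqF.
apply: ler_wpM2r; first by rewrite mulr_ge0 ?ltW.
have le1 (x y : R) : 0 < x -> 0 < y -> x + y = 1 -> x * x <= 1 by move=> *; nra.
apply: lerD; rewrite ler_pM2r ?invr_gt0//.
  exact: (le1 _ _ (pa0 n) (pb0 n) (pab n)).
by apply: (le1 _ _ (pb0 n) (pa0 n)); rewrite addrC pab.
Qed.

Let orthE n k : n != j0 -> k != j0 -> n != k -> \int[N]_z (E n z * E k z) = 0.
Proof.
move=> nj kj nk; pose g (z : X * W) := (c z.1 j0, c z.1 n, c z.1 k).
pose word3 (u v w : A) : J -> A := fun i => if i == j0 then u else if i == n then v else w.
have fib (u v w : A) : g @^-1` [set (u, v, w)] = cylW c [:: j0; n; k] (word3 u v w).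
  apply/seteqP; split=> z /=.
    move=> [zj zn zk] i; rewrite !inE /word3; case: eqP => [->//|_].
    by case: eqP => [->//|_ /= /eqP ->].
  move=> zc; rewrite /g (zc j0) ?inE ?eqxx// (zc n) ?inE ?eqxx ?orbT//.
  rewrite (zc k) ?inE ?eqxx ?orbT//.
  by rewrite /word3 !eqxx (negbTE nj) (negbTE kj) eq_sym (negbTE nk).
have mg tt : measurable (g @^-1` [set tt]).
  by case: tt => [[u v] w]; rewrite fib; exact: measurable_cylW.
have u3 : uniq [:: j0; n; k] by rewrite /= !inE negb_or eq_sym nj eq_sym kj nk.
have w3 (u v w : A) : weight m [:: j0; n; k] (word3 u v w) =
    fine (m j0 [set u]) * (fine (m n [set v]) * fine (m k [set w])).
  rewrite /weight !big_cons big_nil mulr1 /word3 !eqxx (negbTE nj) (negbTE kj).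
  by rewrite eq_sym (negbTE nk).
rewrite (Rintegral_factor N mg (fun x => e n x.1.2 * r n x.1.1 * (e k x.2 * r k x.1.1)) measurableT).
transitivity (\sum_(u : A) \sum_(v : A) \sum_(w : A)
   (e n v * r n u * (e k w * r k u) * weight m [:: j0; n; k] (word3 u v w))).
  rewrite pair_bigA pair_bigA /=; apply: eq_bigr => -[[u v] w] _ /=.
  by rewrite fib setTI -[fine _]/(pr _) pr_cylW.
rewrite !sum2 !w3 /e eqxx eq_sym (negbTE ab) -/(pa n) -/(pb n) -/(pa k) -/(pb k) -/(pa j0) -/(pb j0).
have -> : pb n = 1 - pa n by rewrite -(pab n) addrC addKr.
have -> : pb k = 1 - pa k by rewrite -(pab k) addrC addKr.
by rewrite (_ : true%:R = 1 :> R)// (_ : false%:R = 0 :> R)//; ring.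
Qed.

Variables (t : seq J) (F : set (X * W)).
Hypotheses (mF : measurable F) (lF : local c t F) (jt : j0 \notin t).

Let G := B `&` F.
Let mG : measurable G := measurableI _ _ mB mF.
(* The difference of the conditional measures of G given the two letters at j0. *)
Let gap := pr (G `&` cylW c [:: j0] (fun=> a)) / pa j0
         - pr (G `&` cylW c [:: j0] (fun=> b)) / pb j0.

Let sum_second n (u : A) : n != j0 ->
  pr (G `&` cylW c [:: j0; n] (word2 u a)) + pr (G `&` cylW c [:: j0; n] (word2 u b)) =
  pr (G `&` cylW c [:: j0] (fun=> u)).
Proof.
move=> nj; have mGu := measurableI _ _ mG (measurable_cylW mA c [:: j0] (fun=> u)).
rewrite -(sum_letters n mGu) sum2.
have wE (v : A) : cylW c (W := W) [:: j0; n] (word2 u v) =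
    cylW c [:: j0] (fun=> u) `&` cylW c [:: n] (fun=> v).
  apply/seteqP; split=> z /=.
    move=> zc; split=> i; rewrite inE => /eqP ->.
      by rewrite (zc j0) ?inE ?eqxx// /word2 eqxx.
    by rewrite (zc n) ?inE ?eqxx ?orbT// /word2 (negbTE nj).
  move=> [zj zn] i; rewrite !inE => /orP[|] /eqP ->.
    by rewrite (zj j0) ?inE// /word2 eqxx.
  by rewrite (zn n) ?inE// /word2 (negbTE nj).
by rewrite !wE !setIA.
Qed.

(* The exchange turns the letter at n into the letter at j0. *)
Let meanE n : n != j0 -> n \notin t ->
  \int[N]_(z in G) E n z = pa n * pb n * gap.
Proof.
move=> nj nt; rewrite (E2 nj mG (fun u u' => e n u' * r n u)) !sum2.
have jn : j0 != n by rewrite eq_sym.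
have u2 : uniq [:: j0; n] by rewrite /= inE jn.
have fF v : updW c [:: j0; n] v @^-1` F = F.
  apply: local_upd lF _ => i it; rewrite !inE negb_or.
  by apply/andP; split; apply/eqP => ij; rewrite ij ?(negbTE nt) ?(negbTE jt) in it.
have ex : pa j0 * pb n * pr (G `&` cylW c [:: j0; n] (word2 b a)) =
    pb j0 * pa n * pr (G `&` cylW c [:: j0; n] (word2 a b)).
  by have := swap_exchange u2 (exchangeable jn) mF fF; rewrite !weight2.
rewrite /gap -!(sum_second _ nj).
rewrite /e /r eqxx eq_sym (negbTE ab) -/(pa n) -/(pb n) -/(pa j0) -/(pb j0).
rewrite (_ : true%:R = 1 :> R)// (_ : false%:R = 0 :> R)//.
move: ex; set gab := pr (G `&` cylW c _ (word2 a b)).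
set gba := pr (G `&` cylW c _ (word2 b a)).
set gaa := pr _; set gbb := pr _ => ex.
have p0 : pa j0 != 0 by rewrite gt_eqF.
have q0 : pb j0 != 0 by rewrite gt_eqF.
have q1 : pb n != 0 by rewrite gt_eqF.
have -> : gba = pb j0 * pa n * gab / (pa j0 * pb n).
  by rewrite -ex mulrC mulKf// mulf_neq0.
have qE : pa n = 1 - pb n by rewrite -(pab n) addrK.
by rewrite qE; field; rewrite p0 q0 q1.
Qed.

(* Integrate 2 tau h - tau^2 h^2 <= 1 over G, where h is the sum of the E n over
   s; its mean over G is T * gap and its square has integral at most K * T.  The
   best tau is gap / K, which gives gap^2 * T <= K. *)
Let gap0 : gap = 0.
Proof.
apply/eqP; apply: contraT => gap_neq0.
have p0 := pa0 j0; have q0 := pb0 j0.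
have K0 : 0 < K by rewrite addr_gt0 ?divr_gt0.
have [s [us st sM]] := diverging (j0 :: t) (K / (gap * gap)).
set T := \sum_(j <- s) pa j * pb j in sM.
have snj n : n \in s -> n != j0 by move/st; rewrite inE negb_or => /andP[].
have snt n : n \in s -> n \notin t by move/st; rewrite inE negb_or => /andP[].
pose h z := \sum_(n <- s) E n z.
have sh_ : simple_variable h by apply: simple_variable_sum.
have shh : simple_variable (fun z => h z * h z) by exact: simple_variable_op.
have sEE n k : simple_variable (fun z => E n z * E k z) by exact: simple_variable_op.
have mean : \int[N]_(z in G) h z = T * gap.
  rewrite Rintegral_simple_sum// mulr_suml big_seq [RHS]big_seq.
  by apply: eq_bigr => n ns; rewrite meanE ?snj ?snt.
have square : \int[N]_z (h z * h z) <= K * T.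
  have -> : \int[N]_z (h z * h z) = \sum_(n <- s) \sum_(k <- s) \int[N]_z (E n z * E k z).
    transitivity (\int[N]_z (\sum_(n <- s) \sum_(k <- s) E n z * E k z)).
      apply: eq_Rintegral => z _; rewrite /h mulr_suml; apply: eq_bigr => n _.
      by rewrite mulr_sumr.
    rewrite Rintegral_simple_sum//; last by move=> n; exact: simple_variable_sum.
    by apply: eq_bigr => n _; rewrite Rintegral_simple_sum.
  rewrite /T mulr_sumr big_seq [leRHS]big_seq; apply: ler_sum => n ns.
  rewrite (bigD1_seq n)//= big_seq_cond big1 ?addr0; first by apply: normE; exact: snj.
  by move=> k /andP[ks kn]; apply: orthE; rewrite ?snj// eq_sym.
have squareG : \int[N]_(z in G) (h z * h z) <= \int[N]_z (h z * h z).
  apply: fine_le.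
  - by apply: integrable_fin_num => //; exact: simple_variable_integrable.
  - by apply: integrable_fin_num => //; exact: simple_variable_integrable.
  - apply: ge0_subset_integral => //.
      have /(simple_variable_integrable N (@measurableT _ (X * W)%type)) := shh.
      exact: measurable_int.
    by move=> z _; rewrite lee_fin -expr2 sqr_ge0.
pose tau := gap / K.
have : \int[N]_(z in G) (2 * tau * h z - tau * tau * (h z * h z)) <= \int[N]_(z in G) 1.
  apply: le_Rintegral => //.
  - apply: simple_variable_integrable => //.
    apply: (simple_variable_op (fun x y => x - y)).
      by apply: (simple_variable_op (fun x y => x * y)) => //; exact: simple_variable_cst.
    by apply: (simple_variable_op (fun x y => x * y)) => //; exact: simple_variable_cst.
  - by apply: simple_variable_integrable => //; exact: simple_variable_cst.
  - move=> z _; have := sqr_ge0 (1 - tau * h z); rewrite expr2.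
    by move: (h z) => x; lra.
have ih : N.-integrable G (EFin \o h) by exact: simple_variable_integrable.
have ihh : N.-integrable G (EFin \o (fun z => h z * h z)) by exact: simple_variable_integrable.
rewrite RintegralB//; last 2 first.
- by apply: simple_variable_integrable => //; apply: (simple_variable_op (fun x y => x * y)) => //; exact: simple_variable_cst.
- by apply: simple_variable_integrable => //; apply: (simple_variable_op (fun x y => x * y)) => //; exact: simple_variable_cst.
rewrite RintegralZl// RintegralZl// Rintegral_cst// mul1r mean.
have G1 : fine (N G) <= 1 by exact: fine_prob_le1.
have gg : 0 < gap * gap by rewrite -expr2 exprn_even_gt0.
have ttE : tau * tau * K = tau * gap by rewrite /tau; field; rewrite gt_eqF.
have tg : tau * gap * T > 1.
  rewrite ltr_pdivrMr// in sM; have -> : tau * gap * T = T * (gap * gap) / K.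
    by rewrite /tau; ring.
  by rewrite ltr_pdivlMr// mul1r.
move=> final.
have : tau * tau * (\int[N]_(z in G) (h z * h z)) <= tau * tau * (K * T).
  by rewrite ler_wpM2l ?(le_trans squareG)// -expr2 sqr_ge0.
have -> : tau * tau * (K * T) = tau * gap * T by rewrite mulrA ttE.
lra.
Qed.

Lemma two_letter_independent_at (u : A) :
  fine (N (B `&` F `&` cylW c [:: j0] (fun=> u))) =
  fine (m j0 [set u]) * fine (N (B `&` F)).
Proof.
have p0 := pa0 j0; have q0 := pb0 j0.
have := sum_letters j0 mG; rewrite sum2 => GE.
move: gap0; rewrite /gap => /eqP; rewrite subr_eq0 eqr_div ?lt0r_neq0// => /eqP g0.
have pq := pab j0.
rewrite -[fine (N (B `&` F))]/(pr G) -GE -[LHS]/(pr (G `&` _)).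
case: (alphabet2 u) => ->; rewrite -[LHS]mulr1 -pq mulrDr.
  by rewrite g0 -/(pa j0); ring.
by rewrite -g0 -/(pb j0); ring.
Qed.

End fixed_letter.

Lemma two_letter_independent : letter_independent c m mu P B.
Proof. by move=> j t F u mF lF jt; exact: (two_letter_independent_at mF lF jt u). Qed.

End two_letters.

End letter_independence.

(** * Atoms and conservativity *)

Section atoms.
Context (R : realType) d (A : finMeasurableType d)
  (mA : forall B : set A, measurable B) dX (X : measurableType dX)
  (J : countType) (c : coordinates A X J) (m : J -> probability A R)
  (mu : probability X R) (sh : int -> J -> J) (Q : int -> X -> X)
  (BS : bernoulli_shift c m mu sh Q).
Implicit Types (s t : seq J) (v : J -> A).

(* An increasing exhaustion of the countable set of sites. *)
Let enum_prefix n : seq J := undup (pmap unpickle (iota 0 n)).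

Let mem_enum_prefix j n : (pickle j < n)%N -> j \in enum_prefix n.
Proof.
move=> jn; rewrite mem_undup mem_pmap; apply/mapP; exists (pickle j).
  by rewrite mem_iota.
by rewrite pickleK.
Qed.

Let cyl_atom v : \bigcap_n cyl c (enum_prefix n) v = [set point_of c v].
Proof.
apply/seteqP; split=> x /=.
  move=> xv; apply: (@coord_inj _ _ _ _ _ c) => j; rewrite point_ofK.
  by apply: (xv (pickle j).+1 I); exact: mem_enum_prefix.
by move=> -> n _ j _; rewrite point_ofK.
Qed.

Lemma measurable_atom v : measurable [set point_of c v].
Proof.
by rewrite -cyl_atom; apply: bigcap_measurableType => n _; exact: measurable_cyl.
Qed.

(** A point is the decreasing intersection of the cylinders that it defines. *)
Lemma atom_mass v (e : R) : (forall s, uniq s -> e <= weight m s v) ->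
  e <= fine (mu [set point_of c v]).
Proof.
move=> ev; have mcyl n := measurable_cyl mA c (enum_prefix n) v.
have : fine (mu (cyl c (enum_prefix n) v)) @[n --> \oo] --> fine (mu [set point_of c v]).
  apply: fine_cvg; rewrite fineK; last by apply: fin_num_measure; exact: measurable_atom.
  rewrite -cyl_atom; apply: nonincreasing_cvg_mu => //.
  - by rewrite ltey_eq fin_num_measure.
  - by apply: bigcap_measurableType => n _; exact: mcyl.
  - apply/nonincreasing_seqP => n; apply/subsetPset => x /= xc j jn; apply: xc.
    move: jn; rewrite !mem_undup !mem_pmap => /mapP[i]; rewrite mem_iota => /andP[i0 ik] ->.
    by apply: map_f; rewrite mem_iota i0 (leq_trans ik).
move/cvgr_to_ge; apply; apply: nearW => n.
by rewrite (bs_law BS) ?undup_uniq// ev// undup_uniq.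
Qed.

Hypothesis cQ : conservative mu Q.

(** Conservativity holds at almost every point of [set z], hence at z. *)
Lemma atom_periodic (z : X) : measurable [set z] -> 0 < fine (mu [set z]) ->
  exists2 n : int, n != 0 & Q n z = z.
Proof.
move=> mz z0; have mz0 : (0 < mu [set z])%E.
  by rewrite -[mu _]fineK ?lte_fin// fin_num_measure.
have [Z [mZ Z0 sZ]] := cQ mz mz0.
have inf : infinite_set [set n : int | [set z] (Q n z)].
  apply: contrapT => fin; move: mz0; rewrite lt_neqAle => /andP[/negP ne _]; apply: ne.
  rewrite eq_sym; apply/eqP; apply: (subset_measure0 _ _ _ Z0) => //.
  by move=> _ ->; apply: sZ => /= /(_ erefl).
apply: contrapT => none; apply: inf; apply: (@sub_finite_set _ _ [set 0]).
  by move=> n /= Qn; apply: contrapT => /eqP n0; apply: none; exists n.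
exact: finite_set1.
Qed.

Lemma periodic_mul (z : X) (n k : int) : Q n z = z -> Q (n * k) z = z.
Proof.
have [Q0 QD] := shift_Zaction BS => Qn.
have Qnat (i : nat) : Q (n * i%:Z) z = z.
  elim: i => [|i IHi]; first by rewrite mulr0 Q0.
  by rewrite intS mulrDr mulr1 QD /= IHi.
case: k => i; first exact: Qnat.
rewrite NegzE mulrN -{1}(Qnat i.+1) -[LHS]/((Q _ \o Q _) z) -QD addNr.
by rewrite Q0.
Qed.

(** Some nonzero time fixes both points.  It moves the only site where they differ
to a site where they differ, that is, to itself; this contradicts freeness. *)
Lemma atoms_differing_once (v v' : J -> A) (j0 : J) :
  (forall j, (v j == v' j) = (j != j0)) ->
  0 < fine (mu [set point_of c v]) -> 0 < fine (mu [set point_of c v']) -> False.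
Proof.
move=> vv' v0 v'0.
have [n n0 Qn] := atom_periodic (measurable_atom v) v0.
have [k k0 Qk] := atom_periodic (measurable_atom v') v'0.
have Qv := periodic_mul k Qn.
have Qv' : Q (n * k) (point_of c v') = point_of c v'.
  by rewrite mulrC; exact: periodic_mul.
have inv u : Q (n * k) (point_of c u) = point_of c u -> u (sh (n * k) j0) = u j0.
  move=> /(congr1 (fun x => c x (sh (n * k) j0))).
  by rewrite (bs_coord BS) !point_ofK (shK BS).
have := vv' (sh (n * k) j0); rewrite (inv _ Qv) (inv _ Qv') vv' eqxx /=.
move/esym/negbFE/eqP/(bs_free BS)/eqP.
by rewrite mulf_eq0 (negbTE n0) (negbTE k0).
Qed.

Variables (a b : A).
Hypotheses (ab : a != b) (alphabet2 : forall u : A, u = a \/ u = b).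

Let pa j := fine (m j [set a]).
Let pb j := fine (m j [set b]).

Let pab j : pa j + pb j = 1.
Proof.
rewrite -(sum_alphabet mA m j) (bigD1 a)//= (bigD1 b) 1?eq_sym//= big1 ?addr0// => u /andP[ua ub].
by case: (alphabet2 u) ua ub => ->; rewrite eqxx.
Qed.

Let likely j := if pb j <= pa j then a else b.
Let flip u := if u == a then b else a.

(* With x + y = 1 and y <= x, the inequality exp z >= 1 + z reduces the claim to
   1 <= x (1 + 4 x y). *)
Let likely_bound j : expR (- (4 * (pa j * pb j))) <= fine (m j [set likely j]).
Proof.
have p0 : 0 < pa j := bs_support BS j a; have q0 : 0 < pb j := bs_support BS j b.
have bound (x y : R) : 0 < x -> 0 < y -> x + y = 1 -> y <= x ->
    expR (- (4 * (x * y))) <= x.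
  move=> x0 y0 xy yx; rewrite expRN.
  have := expR_ge1Dx (4 * (x * y)); set E := expR _ => hE.
  have E0 : 0 < E by exact: expR_gt0.
  rewrite -[leLHS]mul1r ler_pdivrMr//.
  have xE : x * (1 + 4 * (x * y)) <= x * E by rewrite ler_pM2l.
  have y2 : y = 1 - x by rewrite -xy addrAC subrr add0r.
  apply: le_trans xE.
  (* The difference of the two sides is y (1 - 2 y) (3 - 2 y). *)
  have : 0 <= y * (1 - 2 * y) * (3 - 2 * y) by rewrite !mulr_ge0//; lra.
  by rewrite y2; lra.
rewrite /likely; case: ifP => pq; first exact: bound.
rewrite [pa j * _]mulrC; apply: bound => //; first by rewrite addrC pab.
by rewrite ltW// ltNge pq.
Qed.

(** If the sums were bounded by M, the configuration of the more likely letters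
would have mass at least exp (- 4 M).  Changing it at one site would give a second
atom, against [atoms_differing_once]. *)
Lemma conservative_diverging_all (j0 : J) (M : R) : exists s,
  uniq s /\ M < \sum_(j <- s) pa j * pb j.
Proof.
apply: contrapT => none.
have bnd s : uniq s -> \sum_(j <- s) pa j * pb j <= M.
  by move=> us; rewrite leNgt; apply/negP => Ms; apply: none; exists s.
have mass : expR (- (4 * M)) <= fine (mu [set point_of c likely]).
  apply: atom_mass => s /bnd sM.
  apply: (@le_trans _ _ (expR (- (4 * \sum_(j <- s) pa j * pb j)))).
    by rewrite ler_expR lerN2 ler_pM2l.
  rewrite mulr_sumr -sumrN expR_sum; apply: ler_prod => j _.
  by rewrite expR_ge0/= likely_bound.
have mass0 : 0 < fine (mu [set point_of c likely]).
  by apply: lt_le_trans mass; exact: expR_gt0.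
pose v' j := if j == j0 then flip (likely j) else likely j.
apply: (@atoms_differing_once likely v' j0) => //.
  move=> j; rewrite /v'; case: (j == j0); last by rewrite eqxx.
  by rewrite /flip; case: (eqVneq (likely j) a) => [->|]; apply/negbTE.
have mat := measurable_atom.
have -> : [set point_of c v'] =
    cyl c [:: j0] v' `&` upd c [:: j0] likely @^-1` [set point_of c likely].
  apply/seteqP; split=> x /=.
    move=> ->; split; first by move=> j _; rewrite point_ofK.
    apply: (@coord_inj _ _ _ _ _ c) => j; rewrite coord_upd !point_ofK inE /v'.
    by case: eqP.
  move=> [xv xl]; apply: (@coord_inj _ _ _ _ _ c) => j; rewrite point_ofK.
  have [jj|jj] := eqVneq j j0; first by rewrite xv// jj inE.
  have := congr1 (fun y => c y j) xl.
  by rewrite coord_upd point_ofK inE (negbTE jj) /v' (negbTE jj).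
rewrite (product_law_upd mA _ _ (bs_law BS))// mulr_gt0//; first exact: weight_gt0 BS _ _.
apply: (lt_le_trans mass0); apply: le_fine_prob => //.
  by apply: measurable_preimage => //; exact: measurable_upd.
by move=> _ -> /=; rewrite upd_id// => j _; rewrite point_ofK.
Qed.

Lemma conservative_diverging (j0 : J) t M : exists s,
  [/\ uniq s, (forall j, j \in s -> j \notin t) & M < \sum_(j <- s) pa j * pb j].
Proof.
have [s [us sM]] := conservative_diverging_all j0 (M + (size t)%:R).
exists [seq j <- s | j \notin t]; split.
- exact: filter_uniq.
- by move=> j; rewrite mem_filter => /andP[].
have le1 : \sum_(j <- s | j \in t) pa j * pb j <= (size t)%:R.
  apply: (@le_trans _ _ (\sum_(j <- s | j \in t) 1)).
    apply: ler_sum => j _; rewrite mulr_ile1 ?fine_ge0//; exact: fine_prob_le1.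
  rewrite -big_filter big_const_seq count_predT iter_addr_0 ler_nat.
  apply: uniq_leq_size; first exact: filter_uniq.
  by move=> j; rewrite mem_filter => /andP[].
move: sM; rewrite (bigID (mem t))/= big_filter; lra.
Qed.

End atoms.

(** * Weak mixing of generalised Bernoulli shifts *)

Section weak_mixing.
Context (R : realType) d (A : finMeasurableType d)
  (mA : forall B : set A, measurable B) dX (X : measurableType dX)
  (J : countType) (c : coordinates A X J) (m : J -> probability A R)
  (mu : probability X R) (sh : int -> J -> J) (Q : int -> X -> X)
  (BS : bernoulli_shift c m mu sh Q) (cQ : conservative mu Q).

Let dQ : divergent_orbits mu Q.
Proof.
apply: conservative_divergent cQ.
- exact: shift_Zaction BS.
- exact: measurable_shift BS.
- exact: bs_nonsingular BS.
Qed.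

Lemma weakly_mixing_of_single_letters :
  (forall j a b, comparable_words m sh [:: j] (fun=> a) (fun=> b)) ->
  weakly_mixing mu Q.
Proof.
move=> cmp dW W P S _ ZS mS PS eS B mB UB.
apply: (letter_independent_trivial mA BS ZS eS mB UB).
exact: (single_letter_independent mA BS dQ ZS mS PS mB UB cmp).
Qed.

Lemma weakly_mixing_of_two_letters (a b : A) (j0 : J) :
  a != b -> (forall u : A, u = a \/ u = b) ->
  (forall i j, i != j -> comparable_words m sh [:: i; j]
    (fun k => if k == i then a else b) (fun k => if k == i then b else a)) ->
  weakly_mixing mu Q.
Proof.
move=> ab alphabet2 cmp dW W P S _ ZS mS PS eS B mB UB.
apply: (letter_independent_trivial mA BS ZS eS mB UB).
apply: (two_letter_independent mA BS dQ ZS mS PS mB UB ab alphabet2 cmp) => t M.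
exact: (conservative_diverging mA BS cQ ab alphabet2 j0).
Qed.

End weak_mixing.

(** Sites with an integer position that the action translates, and marginals that
depend on the position only: the case of Z, and that of p copies of Z. *)
Section positions.
Context (R : realType) d (A : finMeasurableType d)
  (mA : forall B : set A, measurable B) (mu_ : int -> probability A R).
Context (J : countType) (sh : int -> J -> J) (pos : J -> int).
Hypothesis pos_sh : forall k j, pos (sh k j) = pos j + k.
Hypothesis sh_index : is_Zaction sh.

Let m j := mu_ (pos j).

Let shK k j : sh (- k) (sh k j) = j.
Proof.
have [s0 sD] := sh_index.
by have := congr1 (fun f => f j) (sD (- k) k); rewrite addNr s0 /= => <-.
Qed.

Let weight_cons k j s v : weight m (map (sh k) (j :: s)) (shift_word sh k v) =
  fine (mu_ (pos j + k) [set v j]) * weight m (map (sh k) s) (shift_word sh k v).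
Proof. by rewrite /weight /= big_cons /m pos_sh /shift_word shK. Qed.

Let pos_gt0 j (k : nat) : (`|pos j|.+1 <= k)%N -> 0 < pos j + k%:Z.
Proof. lia. Qed.

(** A ratio of two numbers between e and 1 is at most e^-1. *)
Lemma comparable_single (e : R) : 0 < e ->
  (forall n a, 0 < n -> e <= fine (mu_ n [set a])) ->
  forall j a b, comparable_words m sh [:: j] (fun=> a) (fun=> b).
Proof.
move=> e0 emu j a b; exists e^-1, `|pos j|.+1; split; first by rewrite invr_gt0.
move=> k /pos_gt0 jk; rewrite !weight_cons /weight /= !big_nil !mulr1.
have le u u' : fine (mu_ (pos j + k%:Z) [set u]) <=
    e^-1 * fine (mu_ (pos j + k%:Z) [set u']).
  rewrite mulrC ler_pdivlMr//; apply: le_trans (emu _ _ jk).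
  by rewrite -[leRHS]mul1r ler_pM2r// (fine_prob_le1 _ (mA _)).
by split.
Qed.

(** At distance l the marginals have ratios at most L ^+ l.  The two sites keep
their distance D under the action, and each exchange of letters costs L ^+ D at
both of them. *)
Lemma comparable_exchange (L : R) (a b : A) : 0 < L ->
  (forall n u, 0 < n -> fine (mu_ n [set u]) <= L * fine (mu_ (n + 1) [set u])) ->
  (forall n u, 0 < n -> fine (mu_ (n + 1) [set u]) <= L * fine (mu_ n [set u])) ->
  forall i j, i != j -> comparable_words m sh [:: i; j]
    (fun k => if k == i then a else b) (fun k => if k == i then b else a).
Proof.
move=> L0 up down i j ij.
have near n (l : nat) u : 0 < n ->
    fine (mu_ n [set u]) <= L ^+ l * fine (mu_ (n + l%:Z) [set u]) /\
    fine (mu_ (n + l%:Z) [set u]) <= L ^+ l * fine (mu_ n [set u]).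
  move=> n0; elim: l => [|l [IH1 IH2]]; first by rewrite expr0 !mul1r addr0.
  have nl : 0 < n + l%:Z by lia.
  have -> : n + l.+1%:Z = n + l%:Z + 1 by lia.
  rewrite exprSr; split.
    apply: le_trans IH1 _; rewrite -mulrA ler_pM2l ?exprn_gt0//; exact: up.
  by apply: le_trans (down _ _ nl) _; rewrite [_ * L]mulrC -mulrA ler_pM2l.
have far x y u : 0 < x -> 0 < y ->
    fine (mu_ x [set u]) <= L ^+ absz (x - y)%R * fine (mu_ y [set u]).
  move=> x0 y0; have [xy|yx] := lerP x y.
    have [h _] := near x (absz (x - y)%R) u x0.
    have e : x + (absz (x - y)%R)%:Z = y by lia.
    by rewrite e in h.
  have [_ h] := near y (absz (x - y)%R) u y0.
  have e : y + (absz (x - y)%R)%:Z = x by lia.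
  by rewrite e in h.
pose D := absz (pos i - pos j)%R.
exists (L ^+ D * L ^+ D), (maxn `|pos i|.+1 `|pos j|.+1); split.
  by rewrite mulr_gt0 ?exprn_gt0.
move=> k; rewrite geq_max => /andP[/pos_gt0 ik /pos_gt0 jk].
rewrite !weight_cons /weight /= !big_nil !mulr1 eqxx eq_sym (negbTE ij).
have Dij : absz ((pos i + k%:Z) - (pos j + k%:Z))%R = D by rewrite /D; lia.
have Dji : absz ((pos j + k%:Z) - (pos i + k%:Z))%R = D by rewrite /D; lia.
have cmp u u' : fine (mu_ (pos i + k%:Z) [set u]) * fine (mu_ (pos j + k%:Z) [set u']) <=
   L ^+ D * L ^+ D * (fine (mu_ (pos i + k%:Z) [set u']) * fine (mu_ (pos j + k%:Z) [set u])).
  rewrite [X in _ <= _ * X]mulrC mulrACA; apply: ler_pM; rewrite ?fine_ge0//.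
    by rewrite -Dij; exact: far.
  by rewrite -Dji; exact: far.
by split; exact: cmp.
Qed.

End positions.

(** * Finite powers of a nonsingular map *)

Section prod_space.
Context d (Y : measurableType d) (I : Type).

Lemma measurable_to_prod_space dZ (Z : measurableType dZ) (f : Z -> prod_space I Y) :
  (forall i, measurable_fun setT (fun z => f z i)) -> measurable_fun setT f.
Proof.
move=> mf; apply: (@measurability _ _ Z (prod_space I Y) setT f (@cylinders I d Y) erefl).
move=> _ [_ [i _ [B mB <-]] <-]; rewrite !setTI.
exact: (measurable_preimage (mf i) mB).
Qed.

Lemma measurable_prod_space_coord i : measurable_fun setT (fun x : prod_space I Y => x i).
Proof.
by move=> _ B mB; apply: sub_gen_smallest; exists i => //; exists B.
Qed.

End prod_space.

Lemma fine_prod (R : realType) (K : Type) (s : seq K) (F : K -> \bar R) :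
  (forall k, F k \is a fin_num) ->
  fine (\prod_(k <- s) F k)%E = \prod_(k <- s) fine (F k).
Proof.
move=> Ffin; suff -> : (\prod_(k <- s) F k = (\prod_(k <- s) fine (F k))%:E)%E by [].
elim: s => [|k s IHs]; first by rewrite !big_nil.
by rewrite !big_cons IHs EFinM fineK.
Qed.

(** Products of nonsingular maps over finitely many copies of a space.  The copies
are transformed one at a time: mup is the image of mu x mup under the map that
puts a fresh sample into copy i, and it intertwines q x id with the map that
applies q to copy i; so nonsingularity follows from [nonsingular_product]. *)
Section finite_power.
Context (R : realType) d (Y : measurableType d) (I : finType)
  (mu : probability Y R) (mup : probability (prod_space I Y) R)
  (mupP : is_product_measure (fun=> mu) mup).

(** Rectangles constrain all coordinates, which makes them closed under
intersections without any bookkeeping of sites. *)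
Definition power_rects : set (set (prod_space I Y)) :=
  [set D | exists2 B : I -> set Y, forall i, measurable (B i) &
     D = [set x | forall i, B i (x i)]].

Lemma measurable_rect (B : I -> set Y) : (forall i, measurable (B i)) ->
  measurable [set x : prod_space I Y | forall i, B i (x i)].
Proof.
move=> mB; rewrite (_ : [set _ | _] =
    \bigcap_(i in [set: I]) ((fun x : prod_space I Y => x i) @^-1` B i)); last first.
  by apply/seteqP; split=> x /= h i; [move=> _; exact: h|exact: h].
apply: fin_bigcap_measurable; first exact: finite_finset.
by move=> i _; apply: measurable_preimage => //; exact: measurable_prod_space_coord.
Qed.

Lemma measurable_power_rects : @measurable _ (prod_space I Y) = <<s power_rects >>.
Proof.
apply/seteqP; split; apply: smallest_sub => //.
- move=> _ [i _ [B mB <-]]; rewrite setTI; apply: sub_gen_smallest.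
  exists (fun k => if k == i then B else setT) => [k|]; first by case: ifP.
  apply/seteqP; split=> x /=; last by move=> /(_ i); rewrite eqxx.
  by move=> Bx k; case: eqP => [->|].
- split=> [|D mD|F mF]; [exact: measurable0|exact: measurableD|].
  exact: bigcupT_measurable.
- by move=> _ [B mB ->]; exact: measurable_rect.
Qed.

Lemma power_rectsI : setI_closed power_rects.
Proof.
move=> _ _ [B mB ->] [C mC ->]; exists (fun i => B i `&` C i).
  by move=> i; exact: measurableI.
by apply/seteqP; split=> x /=; [move=> [h h'] i|move=> h; split=> i; have [] := h i].
Qed.

Lemma power_rectsT : power_rects setT.
Proof. by exists (fun=> setT) => //; apply/seteqP; split. Qed.

Lemma power_rect_measure (B : I -> set Y) : (forall i, measurable (B i)) ->
  fine (mup [set x | forall i, B i (x i)]) = \prod_(i : I) fine (mu (B i)).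
Proof.
move=> mB; rewrite -big_enum -(@fine_prod _ _ (enum I) (fun i => mu (B i))); last first.
  by move=> i; exact: fin_num_measure.
rewrite -(mupP (enum_uniq _) mB); congr (fine (mup _)).
by apply/seteqP; split=> x /= h i; [move=> _|apply: h; rewrite mem_enum].
Qed.

Let set_coord (i : I) (yx : Y * prod_space I Y) : prod_space I Y :=
  fun k => if k == i then yx.1 else yx.2 k.

Let measurable_set_coord i : measurable_fun setT (set_coord i).
Proof.
apply: measurable_to_prod_space => k; rewrite /set_coord; case: (k == i).
  exact: measurable_fst.
exact: (measurableT_comp (measurable_prod_space_coord k) (@measurable_snd _ _ _ _)).
Qed.

Let set_coord_measure i D : measurable D ->
  fine (mup D) = fine ((mu \x mup)%E (set_coord i @^-1` D)).
Proof.
pose M : probability (Y * prod_space I Y)%type R := (mu \x mup)%E.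
move=> mD.
have := @scaled_measure_unique _ _ _ mup _ _ M _ _ power_rects id (set_coord i)
  setT setT 1 measurable_power_rects power_rectsI power_rectsT.
move=> /(_ (@measurable_id _ _ _) (measurable_set_coord i) measurableT measurableT ler01).
rewrite -[D in LHS]setTI -[_ @^-1` D in RHS]setTI.
move=> unq; rewrite -[RHS]mul1r; apply: unq => // {mD}D [B mB ->].
rewrite !setTI mul1r preimage_id power_rect_measure//.
pose B' k := if k == i then setT else B k.
have mB' k : measurable (B' k) by rewrite /B'; case: ifP.
have -> : set_coord i @^-1` [set x | forall k, B k (x k)] =
    B i `*` [set x | forall k, B' k (x k)].
  apply/seteqP; split=> -[y x] /=; rewrite /set_coord /B'.
    move=> h; split; first by have := h i; rewrite eqxx.
    by move=> k; have := h k; case: ifP.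
  by move=> [Bi h] k; have := h k; case: eqP => [->|].
have -> : M (B i `*` [set x | forall k, B' k (x k)]) =
    (mu (B i) * mup [set x | forall k, B' k (x k)])%E.
  by apply: product_measure1E => //; exact: measurable_rect.
rewrite fineM ?fin_num_measure//; last exact: measurable_rect.
rewrite power_rect_measure// (bigD1 i)//= [in RHS](bigD1 i)//= /B' eqxx fine_probT mul1r.
by congr (_ * _); apply: eq_bigr => k /negbTE ->.
Qed.

Variable q : Y -> Y.
Hypotheses (mq : measurable_fun setT q)
  (nsq : forall B, measurable B -> mu B = 0%E -> mu (q @^-1` B) = 0%E).

Let on_coords (l : seq I) (x : prod_space I Y) : prod_space I Y :=
  fun k => if k \in l then q (x k) else x k.

Let measurable_on_coords l : measurable_fun setT (on_coords l).
Proof.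
apply: measurable_to_prod_space => k; rewrite /on_coords; case: (k \in l).
  by apply: measurableT_comp => //; exact: measurable_prod_space_coord.
exact: measurable_prod_space_coord.
Qed.

Let nonsingular_coord i D : measurable D -> mup D = 0%E ->
  mup (on_coords [:: i] @^-1` D) = 0%E.
Proof.
move=> mD D0; have mpre D' : measurable D' -> measurable (set_coord i @^-1` D').
  by move=> mD'; exact: (measurable_preimage (measurable_set_coord i) mD').
have mD' := measurable_preimage (measurable_on_coords [:: i]) mD.
pose M : probability (Y * prod_space I Y)%type R := (mu \x mup)%E.
have e : M (set_coord i @^-1` D) = 0%E.
  by apply: (fine_prob_eq0 M (mpre _ mD)).1; rewrite -(set_coord_measure i mD) D0.
apply: (fine_prob_eq0 mup mD').1; rewrite (set_coord_measure i mD').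
apply: (fine_prob_eq0 M (mpre _ mD')).2.
have := @nonsingular_product _ _ _ mu _ _ mup q id mq
  (fun B _ => erefl) _ nsq (mpre _ mD) e.
rewrite (_ : _ @^-1` (set_coord i @^-1` D) = set_coord i @^-1` (on_coords [:: i] @^-1` D))//.
apply/seteqP; split=> -[y x] /=; rewrite (_ : set_coord i (q y, x) =
    on_coords [:: i] (set_coord i (y, x)))//;
  by apply/funext => k; rewrite /set_coord /on_coords inE; case: eqP.
Qed.

Lemma nonsingular_power D : measurable D -> mup D = 0%E ->
  mup ((fun x : prod_space I Y => (fun i => q (x i)) : prod_space I Y) @^-1` D) = 0%E.
Proof.
have main (l : seq I) : uniq l -> forall C, measurable C -> mup C = 0%E ->
    mup (on_coords l @^-1` C) = 0%E.
  elim: l => [|i l IHl] /= => [_|/andP[il ul]] C mC C0.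
    by rewrite (_ : on_coords [::] = id)//; apply/funext.
  have -> : on_coords (i :: l) = on_coords [:: i] \o on_coords l.
    apply/funext => x; apply/funext => k; rewrite /on_coords /= !inE.
    by have [->|] := eqVneq k i; rewrite ?(negbTE il).
  rewrite comp_preimage; apply: IHl => //; last exact: nonsingular_coord.
  exact: (measurable_preimage (measurable_on_coords [:: i]) mC).
move=> mD D0; have := main (enum I) (enum_uniq _) D mD D0.
congr (mup _ = _); apply: (congr1 (fun f => f @^-1` D)); apply/funext => x.
by apply/funext => k; rewrite /on_coords mem_enum.
Qed.

End finite_power.

(** * The shift and its powers *)

Section bernoulli_coordinates.
Context d (A : measurableType d) (p : nat).

Definition seq_coordinates : coordinates A (prod_space int A) int :=
  @Coordinates _ A _ (prod_space int A) int (fun x n => x n) (fun x => x)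
    (fun=> erefl) (fun=> erefl) erefl.

Let X := prod_space 'I_p (prod_space int A).

Let G : set (set X) := \bigcup_(j in [set: 'I_p * int])
  preimage_set_system setT (fun x : X => x j.1 j.2) measurable.

(* The p-fold product of the product sigma-algebra is generated by the single
   letters. *)
Let measurable_double_coord : @measurable _ X = <<s G >>.
Proof.
apply/seteqP; split; apply: smallest_sub => //.
- move=> _ [i _ [B mB <-]]; rewrite setTI.
  have mi : measurable_fun setT (fun x : g_sigma_algebraType G => x i : prod_space int A).
    apply: measurable_to_prod_space => n _ C mC; apply: sub_gen_smallest.
    by exists (i, n) => //; exists C.
  exact: (measurable_preimage mi mB).
- split=> [|D mD|F mF]; [exact: measurable0|exact: measurableD|].
  exact: bigcupT_measurable.
- move=> _ [[i n] _ [B mB <-]]; rewrite setTI /=.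
  have mi := measurable_prod_space_coord (Y := prod_space int A) i.
  have mn := measurable_prod_space_coord (Y := A) n.
  exact: (measurable_preimage (measurableT_comp mn mi) mB).
Qed.

Let pointK : cancel (fun (f : 'I_p * int -> A) => (fun i n => f (i, n)) : X)
  (fun (x : X) j => x j.1 j.2).
Proof. by move=> f; apply/funext => -[]. Qed.

Definition power_coordinates : coordinates A X ('I_p * int) :=
  @Coordinates _ A _ X _ _ _ pointK (fun=> erefl) measurable_double_coord.

End bernoulli_coordinates.

Definition translate (k n : int) : int := n + k.

Definition translate_copy p (k : int) (j : 'I_p * int) : 'I_p * int :=
  (j.1, translate k j.2).

Lemma translate_Zaction : is_Zaction translate.
Proof.
split=> [|m n]; first by apply/funext => k; rewrite /translate addr0.
by apply/funext => k; rewrite /translate /= -addrA [n + m]addrC.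
Qed.

Lemma translate_copy_Zaction p : is_Zaction (@translate_copy p).
Proof.
have [t0 tD] := translate_Zaction.
split=> [|m n]; first by apply/funext => -[i k]; rewrite /translate_copy t0.
by apply/funext => -[i k]; rewrite /translate_copy tD.
Qed.

Section bernoulli_systems.
Context (R : realType) d (A : finMeasurableType d)
  (mA : forall B : set A, measurable B)
  (mu_ : int -> probability A R) (mu : probability (prod_space int A) R)
  (mu_prod : is_product_measure mu_ mu) (nsT : shift_nonsingular mu).

Lemma seq_product_law : product_law (seq_coordinates A) mu_ mu.
Proof.
move=> s v us; rewrite /weight -fine_prod; last by move=> n; exact: fin_num_measure.
by rewrite -(mu_prod (B := fun n => [set v n]) us (fun=> mA _)).
Qed.

Let Q := shift_action A.

Let QD m n x : Q m (Q n x) = Q (m + n) x.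
Proof. by rewrite /Q (proj2 (shift_action_Zaction A)). Qed.

Let Q0 x : Q 0 x = x.
Proof. by rewrite /Q (proj1 (shift_action_Zaction A)). Qed.

Let mQ n : measurable_fun setT (Q n).
Proof.
by apply: measurable_to_prod_space => k; exact: measurable_prod_space_coord.
Qed.

(** The image of C under the shift T is its preimage under T^-1, so nonsingularity
of T gives null preimages under T and T^-1, hence under all powers. *)
Lemma shift_action_nonsingular n B : measurable B -> mu B = 0%E ->
  mu (Q n @^-1` B) = 0%E.
Proof.
have image C : seq_shift @` C = Q (- 1) @^-1` C.
  apply/seteqP; split=> x /=.
    by move=> [y Cy <-]; rewrite -shift_action1 -/Q QD addNr Q0.
  by move=> Cx; exists (Q (- 1) x) => //; rewrite -shift_action1 -/Q QD subrr Q0.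
have mpre k C : measurable C -> measurable (Q k @^-1` C).
  by move=> mC; exact: measurable_preimage (mQ k) mC.
have pre k l C : Q k @^-1` (Q l @^-1` C) = Q (l + k) @^-1` C.
  by apply/seteqP; split=> x /=; rewrite QD.
have down C : measurable C -> mu C = 0%E -> mu (Q (- 1) @^-1` C) = 0%E.
  by move=> mC C0; rewrite -image; apply/nsT.
have up C : measurable C -> mu C = 0%E -> mu (Q 1 @^-1` C) = 0%E.
  move=> mC C0; apply/nsT; first exact: mpre.
  rewrite image pre subrr (_ : _ @^-1` C = C)//.
  by apply/seteqP; split=> x /=; rewrite Q0.
move=> mB B0; case: n => k.
  elim: k => [|k IHk].
    by rewrite (_ : _ @^-1` B = B)//; apply/seteqP; split=> x /=; rewrite Q0.
  by rewrite intS addrC -pre; apply: up => //; exact: mpre.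
rewrite NegzE; elim: k => [|k IHk]; first exact: down.
by rewrite intS opprD addrC -pre; apply: down => //; exact: mpre.
Qed.

(** A letter of probability zero at site n gives a null cylinder, and its
translates are null by nonsingularity; one of them sits at a positive site. *)
Lemma marginals_support : (forall n a, 0 < n -> (0 < mu_ n [set a])%E) ->
  forall n a, 0 < fine (mu_ n [set a]).
Proof.
move=> pos n a; rewrite lt_neqAle fine_prob_ge0 andbT eq_sym; apply/eqP => na0.
have law k : fine (mu (cyl (seq_coordinates A) [:: k] (fun=> a))) = fine (mu_ k [set a]).
  by rewrite seq_product_law// /weight big_seq1.
have mC k := measurable_cyl mA (seq_coordinates A) [:: k] (fun=> a).
pose k := (absz n).+1.
have nk : 0 < n + k%:Z by rewrite /k; lia.
have : mu (cyl (seq_coordinates A) [:: n + k%:Z] (fun=> a)) = 0%E.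
  have c0 : mu (cyl (seq_coordinates A) [:: n] (fun=> a)) = 0%E.
    by apply: (fine_prob_eq0 mu (mC n)).1; rewrite law.
  have := shift_action_nonsingular (- k%:Z) (mC n) c0.
  rewrite (_ : _ @^-1` _ = cyl (seq_coordinates A) [:: n + k%:Z] (fun=> a))//.
  apply/seteqP; split=> x /= h j; rewrite inE => /eqP ->.
    by have := h n (mem_head n [::]); rewrite /= /Q /shift_action opprK.
  by rewrite /Q /shift_action /= opprK; apply: h; rewrite inE.
move=> /(congr1 fine); rewrite law => nk0.
by have := pos _ a nk; rewrite -[mu_ _ _]fineK ?fin_num_measure// nk0 ltxx.
Qed.

Hypothesis support : forall n a, 0 < fine (mu_ n [set a]).

Lemma seq_bernoulli_shift :
  bernoulli_shift (seq_coordinates A) mu_ mu translate Q.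
Proof.
split=> //.
- exact: seq_product_law.
- exact: translate_Zaction.
- by move=> n j; rewrite /translate; lia.
- by move=> n B; exact: shift_action_nonsingular.
Qed.

Variables (p : nat) (mup : probability (prod_space 'I_p (prod_space int A)) R).
Hypothesis mupP : is_product_measure (fun=> mu) mup.

(** Group the prescribed letters by copies: the cylinder becomes a rectangle whose
sides are cylinders. *)
Lemma power_product_law :
  product_law (power_coordinates A p) (fun j => mu_ j.2) mup.
Proof.
move=> s v us.
pose t (i : 'I_p) := [seq j.2 | j <- s & j.1 == i].
have ut i : uniq (t i).
  rewrite map_inj_in_uniq ?filter_uniq// => -[i1 n1] [i2 n2].
  by rewrite !mem_filter /= => /andP[/eqP -> _] /andP[/eqP -> _] ->.
pose C (i : 'I_p) := cyl (seq_coordinates A) (t i) (fun n => v (i, n)).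
have -> : cyl (power_coordinates A p) s v = [set x | forall i, C i (x i)].
  apply/seteqP; split=> x /= h.
    by move=> i n /mapP[[i' n']]; rewrite mem_filter => /andP[/= /eqP -> si ->]; exact: h si.
  move=> [i n] si; apply: (h i n); apply/mapP; exists (i, n) => //.
  by rewrite mem_filter eqxx.
rewrite (power_rect_measure mupP) => [|i]; last exact: measurable_cyl.
under eq_bigr => i _ do rewrite seq_product_law// /weight big_map big_filter.
rewrite (exchange_big_dep xpredT)//= /weight; apply: eq_bigr => -[i n] _ /=.
rewrite (bigD1 i)//= big1 ?mulr1// => i' /andP[/eqP ->]; by rewrite eqxx.
Qed.

Lemma power_bernoulli_shift : bernoulli_shift (power_coordinates A p)
  (fun j => mu_ j.2) mup (@translate_copy p) (power_action p Q).
Proof.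
split=> //.
- exact: power_product_law.
- exact: translate_copy_Zaction.
- by move=> n [i k] [] /=; rewrite /translate; lia.
- move=> n B; apply: (nonsingular_power mupP (mQ n)) => C.
  exact: shift_action_nonsingular.
Qed.

End bernoulli_systems.

Section hypotheses.
Context (R : realType) d (A : finMeasurableType d)
  (mA : forall B : set A, measurable B) (mu_ : int -> probability A R).

Lemma inf_min_pos_lower_bound : inf_min_pos mu_ -> exists2 e : R, 0 < e &
  forall n a, 0 < n -> e <= fine (mu_ n [set a]).
Proof.
rewrite /inf_min_pos; set I := ereal_inf _ => I0.
have [e e0 eI] : exists2 e : R, 0 < e & (e%:E <= I)%E.
  by case: I I0 => [r||] // r0; [exists r|exists 1 => //; exact: leey].
exists e => // n a n0; rewrite -lee_fin fineK ?fin_num_measure//.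
apply: (le_trans eI); apply: (@le_trans _ _ (\big[mine/+oo]_(a : A) mu_ n [set a])%E).
  by apply: ereal_inf_lbound; exists n.
exact: bigmin_le.
Qed.

Lemma log_ratio_bounded_ratio : log_ratio_bounded mu_ -> exists2 L : R, 0 < L &
  (forall n u, 0 < n -> fine (mu_ n [set u]) <= L * fine (mu_ (n + 1) [set u])) /\
  (forall n u, 0 < n -> fine (mu_ (n + 1) [set u]) <= L * fine (mu_ n [set u])).
Proof.
move=> [pos]; set M := ereal_sup _ => Mfin.
have lnM n u : 0 < n ->
    (`|ln (fine (mu_ n [set u]) / fine (mu_ (n + 1) [set u]))|%:E <= M)%E.
  move=> n0; apply: (@le_trans _ _ (\big[maxe/-oo]_(a : A)
      `|ln (fine (mu_ n [set a]) / fine (mu_ (n + 1)%R [set a]))|%:E)%E).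
    exact: le_bigmax.
  by apply: ereal_sup_ubound; exists n.
have pos' n u : 0 < n -> 0 < fine (mu_ n [set u]).
  by move=> /(pos _ u); rewrite -{1}[mu_ _ _]fineK ?fin_num_measure// lte_fin.
have bound n u : 0 < n ->
    fine (mu_ n [set u]) / fine (mu_ (n + 1) [set u]) <= expR (fine M) /\
    fine (mu_ (n + 1) [set u]) / fine (mu_ n [set u]) <= expR (fine M).
  move=> n0; have n1 : 0 < n + 1 by lia.
  have x0 := pos' n u n0; have y0 := pos' (n + 1) u n1.
  have h := lnM n u n0; set x := fine (mu_ n _) in x0 h *; set y := fine _ in y0 h *.
  have hM : `|ln (x / y)| <= fine M.
    have M0 : (0 <= M)%E by apply: le_trans h; rewrite lee_fin.
    by rewrite -lee_fin fineK// ge0_fin_numE.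
  move: hM; rewrite ler_norml => /andP[hl hu].
  have xy : 0 < x / y by rewrite divr_gt0.
  split; first by rewrite -[leLHS]lnK ?posrE// ler_expR.
  have yx : 0 < y / x by rewrite divr_gt0.
  rewrite -[leLHS]lnK ?posrE// ler_expR -[y / x]invrK invf_div lnV ?posrE//.
  by rewrite lerNl.
exists (expR (fine M)); first exact: expR_gt0.
split=> n u n0; have [h1 h2] := bound n u n0.
  by rewrite -ler_pdivrMr// pos'//; lia.
by rewrite -ler_pdivrMr// pos'.
Qed.

Lemma two_letter_alphabet : #|A| = 2%N ->
  exists a b : A, a != b /\ forall u : A, u = a \/ u = b.
Proof.
rewrite cardE; have := enum_uniq A; have : forall u : A, u \in enum A by move=> u; rewrite mem_enum.
case: (enum A) => [|a [|b [|]]] //= mem; rewrite inE andbT => ab _.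
exists a, b; split=> // u; have := mem u; rewrite !inE => /orP[/eqP|/eqP]; by [left|right].
Qed.

End hypotheses.

Theorem theorem0p1 (R : realType) (d : measure_display) (A : finMeasurableType d)
    (A_discrete : forall B : set A, measurable B)
    (mu_ : int -> probability A R)
    (mu : probability (prod_space int A) R)
    (mu_prod : is_product_measure mu_ mu)
    (T_nonsingular : shift_nonsingular mu) :
  [/\ (inf_min_pos mu_ ->
       conservative mu (shift_action A) -> weakly_mixing mu (shift_action A)),
      (#|A| = 2%N -> log_ratio_bounded mu_ ->
       conservative mu (shift_action A) -> weakly_mixing mu (shift_action A))
    & (inf_min_pos mu_ \/ (#|A| = 2%N /\ log_ratio_bounded mu_) ->
       forall (p : nat) (mup : probability (prod_space 'I_p (prod_space int A)) R),
         (1 < p)%N ->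
         is_product_measure (fun=> mu) mup ->
         conservative mup (power_action p (shift_action A)) ->
         weakly_mixing mup (power_action p (shift_action A)))].
Proof.
have supp := marginals_support A_discrete mu_prod T_nonsingular.
have suppi : inf_min_pos mu_ -> forall n a, 0 < fine (mu_ n [set a]).
  move=> /(inf_min_pos_lower_bound A_discrete)[e e0 eP]; apply: supp => n a n0.
  rewrite -[mu_ _ _]fineK ?fin_num_measure// lte_fin.
  exact: lt_le_trans e0 (eP _ _ n0).
have suppl : log_ratio_bounded mu_ -> forall n a, 0 < fine (mu_ n [set a]).
  by move=> [pos _]; exact: supp.
split.
- move=> hinf cQ.
  have BS := seq_bernoulli_shift A_discrete mu_prod T_nonsingular (suppi hinf).
  have [e e0 eP] := inf_min_pos_lower_bound A_discrete hinf.
  apply: (weakly_mixing_of_single_letters A_discrete BS cQ).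
  exact: (comparable_single A_discrete (sh := translate) (pos := id) (fun _ _ => erefl) translate_Zaction e0 eP).
- move=> A2 hlog cQ.
  have BS := seq_bernoulli_shift A_discrete mu_prod T_nonsingular (suppl hlog).
  have [L L0 [up down]] := log_ratio_bounded_ratio A_discrete hlog.
  have [a [b [ab alphabet2]]] := two_letter_alphabet A2.
  apply: (weakly_mixing_of_two_letters A_discrete BS cQ (0 : int) ab alphabet2).
  exact: (comparable_exchange (sh := translate) (pos := id) (fun _ _ => erefl) translate_Zaction a b L0 up down).
- move=> hyp p mup p1 mupP cQ; case: hyp => [hinf|[A2 hlog]].
    have BS := power_bernoulli_shift A_discrete mu_prod T_nonsingular (suppi hinf) mupP.
    have [e e0 eP] := inf_min_pos_lower_bound A_discrete hinf.
    apply: (weakly_mixing_of_single_letters A_discrete BS cQ).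
    exact: (comparable_single A_discrete (sh := @translate_copy p) (pos := snd)
      (fun _ _ => erefl) (@translate_copy_Zaction p) e0 eP).
  have BS := power_bernoulli_shift A_discrete mu_prod T_nonsingular (suppl hlog) mupP.
  have [L L0 [up down]] := log_ratio_bounded_ratio A_discrete hlog.
  have [a [b [ab alphabet2]]] := two_letter_alphabet A2.
  apply: (weakly_mixing_of_two_letters A_discrete BS cQ (Ordinal (ltnW p1), 0 : int) ab alphabet2).
  exact: (comparable_exchange (sh := @translate_copy p) (pos := snd)
      (fun _ _ => erefl) (@translate_copy_Zaction p) a b L0 up down).
Qed.
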